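(* Let $(u,p)$ be a local $C^\infty$ space-time solution (near the origin) of the incompressible Euler equations with unit density in three space dimensions and with $p>0$. Let $g$ and $y_g$ be a $t$-dependent Riemannian metric and a $C^\infty$ isometric embedding $y_g$ into $\mathbb{R}^6$ (so $\partial_iy_g\cdot\partial_jy_g=g_{ij}$), defined locally in space-time near the origin, with $\mathrm{Riem}(g)=\widehat R$ and $g_{ij}=\delta_{ij}$ at the origin, i.e. the geometric image of the Euler flow. Let $g^*$ be the shear metric described in the context, with the constant $B>0$ sufficiently large that $g\le g^*$ in the sense of quadratic forms (so that $y_g$ is short relative to $g^*$). Then, locally in space-time, $y_g$ can be approximated in $C^0$ by $C^1$ embeddings $y_w$ into $\mathbb{R}^6$ which are isometric for $g^*$, i.e. $\partial_iy_w\cdot\partial_jy_w=g^*_{ij}$. Furthermore, the energy $$E(t)=\int_\Omega \partial_iy_w\cdot\partial_iy_w\,dx=\int_\Omega \mathrm{tr}(g^* )\,dx$$ is constant in $t$ ($\Omega$ the local spatial domain). In addition, $y_w$ is continuous in $t$ taking values in $C^1_{\rm loc}$.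
   Context: Summation over repeated indices is used; $\partial_i=\partial/\partial x_i$, $i=1,2,3$. The incompressible Euler equations with unit density are $\partial_tu_i+\partial_j(u_iu_j)+\partial_ip=0$, $\operatorname{div}u=0$ (so $\Delta p=-\operatorname{div}\operatorname{div}(u\otimes u)$), corresponding to $\rho=1$, $T_{ij}=-p\,\delta_{ij}$. Christoffel symbols: $\Gamma_{ij}^k=\frac12 g^{kl}(\partial_ig_{jl}+\partial_jg_{il}-\partial_lg_{ij})$; $\mathrm{Riem}(g)$ is the covariant curvature tensor $R_{ijkl}=g_{iq}(\partial_k\Gamma_{lj}^q-\partial_l\Gamma_{kj}^q+\Gamma_{kp}^q\Gamma_{lj}^p-\Gamma_{lp}^q\Gamma_{kj}^p)$, with $t$ a parameter. The tensor $\widehat R$ has the algebraic symmetries of a curvature tensor (skew-symmetries, interchange symmetry, first Bianchi identity) and $$\widehat R_{2323}=u_1^2+p,\quad \widehat R_{1313}=u_2^2+p,\quad \widehat R_{1212}=u_3^2+p,\quad \widehat R_{3123}=u_1u_2,\quad \widehat R_{1223}=u_1u_3,\quad \widehat R_{3112}=u_2u_3.$$ For $p>0$ the corresponding $3\times3$ matrix is positive definite, and such $g$ and $y_g$ exist locally. Shear metric $g^*$: for a steady shear flow $u_1=u_1(x_2)$, $u_2=u_3=p=0$ and a constant $B>0$, consider the embedding $y=(Bx_2,\,Bx_1,\,f(x_2),\,Bx_3,\,0,\,0)$ into $\mathbb{R}^6$, with $f'(x_2)=B\arctan\!\big(-B\int_0^{x_2}u_1^2(s)\,ds\big)$. Its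 induced metric is $$g^*_{11}=g^*_{33}=B^2,\quad g^*_{22}=B^2+(f')^2,\quad g^*_{12}=g^*_{13}=g^*_{23}=0,$$ which is Riemann flat. An embedding inducing $g$ is called short relative to $g^*$ if $g\le g^*$ as quadratic forms. ''Approximated in $C^0$'' means: for every $\varepsilon>0$ such a $y_w$ can be chosen with $\|y_g-y_w\|_{C^0}\le\varepsilon$. *)

(* Defs.v *)
From HB Require Import structures.
From mathcomp Require Import all_boot all_order all_algebra.
From mathcomp Require Import all_classical all_reals all_analysis.
Set Implicit Arguments.
Unset Strict Implicit.
Unset Printing Implicit Defensive.
Import Order.TTheory GRing.Theory Num.Theory.
Import numFieldNormedType.Exports.
Local Open Scope classical_set_scope.
Local Open Scope ring_scope.

(* The spatial coordinates x_1, x_2, x_3 are x 0 (0 : 'I_3), x 0 1, x 0 2. *)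

Definition partial (R : realType) (n : nat) (V : normedModType R) (i : 'I_n)
  (f : 'rV[R]_n -> V) (x : 'rV[R]_n) : V := 'D_(delta_mx 0 i) f x.

Definition dotv (R : realType) (m : nat) (a b : 'rV[R]_m) : R :=
  \sum_k a 0 k * b 0 k.

(* C^k on A, meant for open A. In finite dimension, asking for all iterated
   directional derivatives is the same as asking for iterated partials. *)
Fixpoint Ck_on (R : realType) (V W : normedModType R) (k : nat) (A : set V)
    (f : V -> W) {struct k} : Prop :=
  if k is k'.+1 then
    (forall x, A x -> differentiable f x) /\
    (forall v : V, Ck_on k' A ('D_v f))
  else forall x, A x -> {for x, continuous f}.

Definition smooth_on (R : realType) (V W : normedModType R) (A : set V)
  (f : V -> W) : Prop := forall k, Ck_on k A f.

(* Immersion that is a homeomorphism onto its image, h being the inverse;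
   used together with Ck_on or smooth_on, which give the regularity of y. *)
Definition embedding_on (R : realType) (n m : nat) (A : set 'rV[R]_n)
    (y : 'rV[R]_n -> 'rV[R]_m) : Prop :=
  (forall x, A x -> injective ('d y x : 'rV[R]_n -> 'rV[R]_m)) /\
  exists h : 'rV[R]_m -> 'rV[R]_n,
    (forall x, A x -> h (y x) = x) /\ {within y @` A, continuous h}.

Definition slice (R : realType) (n : nat) (W : set (R * 'rV[R]_n)) (t : R) :
  set 'rV[R]_n := [set x | W (t, x)].

Definition induced_metric (R : realType) (n m : nat)
    (y : 'rV[R]_n -> 'rV[R]_m) (x : 'rV[R]_n) : 'M[R]_n :=
  \matrix_(i, j) dotv (partial i y x) (partial j y x).

Definition quadform (R : realType) (n : nat) (g : 'M[R]_n) (v : 'rV[R]_n) : R :=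
  \sum_i \sum_j g i j * v 0 i * v 0 j.

Definition riemannian_at (R : realType) (n : nat) (g : 'M[R]_n) : Prop :=
  (forall i j, g i j = g j i) /\
  (forall v : 'rV[R]_n, v != 0 -> 0 < quadform g v).

(* christoffel g i j k is Gamma_{ij}^k. *)
Definition christoffel (R : realType) (n : nat) (g : 'rV[R]_n -> 'M[R]_n)
    (i j k : 'I_n) (x : 'rV[R]_n) : R :=
  2^-1 * \sum_l invmx (g x) k l *
    (partial i (fun z => g z j l) x + partial j (fun z => g z i l) x
     - partial l (fun z => g z i j) x).

(* riem g i j k l is R_{ijkl}. *)
Definition riem (R : realType) (n : nat) (g : 'rV[R]_n -> 'M[R]_n)
    (i j k l : 'I_n) (x : 'rV[R]_n) : R :=
  \sum_q g x i q *
    (partial k (christoffel g l j q) x - partial l (christoffel g k j q) x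
     + \sum_r (christoffel g k r q x * christoffel g l j r x
               - christoffel g l r q x * christoffel g k j r x)).

Definition curvature_symmetries (R : realType) (n : nat)
    (C : 'I_n -> 'I_n -> 'I_n -> 'I_n -> R) : Prop :=
  [/\ forall i j k l, C j i k l = - C i j k l,
      forall i j k l, C i j l k = - C i j k l,
      forall i j k l, C k l i j = C i j k l
    & forall i j k l, C i j k l + C i k l j + C i l j k = 0].

(* The tensor \hat R of a velocity u and a pressure p at one point; its
   remaining components are determined by the symmetries. *)
Definition euler_curvature (R : realType) (u : 'rV[R]_3) (p : R)
    (C : 'I_3 -> 'I_3 -> 'I_3 -> 'I_3 -> R) : Prop :=
  let i1 : 'I_3 := 0 in let i2 : 'I_3 := 1 in let i3 : 'I_3 := 2%:R in
  curvature_symmetries C /\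
  [/\ C i2 i3 i2 i3 = u 0 i1 ^+ 2 + p,
      C i1 i3 i1 i3 = u 0 i2 ^+ 2 + p
    & C i1 i2 i1 i2 = u 0 i3 ^+ 2 + p] /\
  [/\ C i3 i1 i2 i3 = u 0 i1 * u 0 i2,
      C i1 i2 i2 i3 = u 0 i1 * u 0 i3
    & C i3 i1 i1 i2 = u 0 i2 * u 0 i3].

Definition euler_at (R : realType) (u : R -> 'rV[R]_3 -> 'rV[R]_3)
    (p : R -> 'rV[R]_3 -> R) (t : R) (x : 'rV[R]_3) : Prop :=
  (forall i : 'I_3,
     'D_1 (fun s : R => u s x 0 i) t
     + \sum_j partial j (fun z => u t z 0 i * u t z 0 j) x
     + partial i (p t) x = 0) /\
  \sum_i partial i (fun z => u t z 0 i) x = 0.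

(* Integral of h from 0 to s, oriented when s < 0. *)
Definition integral_from0 (R : realType) (h : R -> R) (s : R) : R :=
  if 0 <= s then \int[lebesgue_measure]_(r in `[0, s]) h r
  else - \int[lebesgue_measure]_(r in `[s, 0]) h r.

(* The function f' attached to the shear flow u = (w(x_2), 0, 0), p = 0. *)
Definition shear_slope (R : realType) (B : R) (w : R -> R) (s : R) : R :=
  B * atan (- B * integral_from0 (fun r => w r ^+ 2) s).

Definition shear_embedding (R : realType) (B : R) (f : R -> R)
    (x : 'rV[R]_3) : 'rV[R]_6 :=
  \row_k nth 0 [:: B * x 0 1; B * x 0 0; f (x 0 1); B * x 0 2%:R; 0; 0] k.

Definition shear_metric (R : realType) (B : R) (w : R -> R)
    (x : 'rV[R]_3) : 'M[R]_3 :=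
  \matrix_(i, j)
    if i != j then 0
    else if i == 1 then B ^+ 2 + shear_slope B w (x 0 1) ^+ 2
    else B ^+ 2.

Lemma is_derive_coord (R : realType) (n : nat) (phi : R -> R) (j : 'I_n)
    (v x : 'rV[R]_n) (d : R) :
  is_derive (x 0 j) 1 phi d ->
  is_derive x v (fun z : 'rV[R]_n => phi (z 0 j)) (v 0 j * d).
Proof.
move=> [dphi phi'].
have dd : differentiable phi (x 0 j) by apply/derivable1_diffP.
have E : (fun h : R => h^-1 *: (((fun z : 'rV[R]_n => phi (z 0 j)) \o shift x)
             (h *: v) - phi (x 0 j)))
       = (fun h : R => h^-1 *: ((phi \o shift (x 0 j)) (h *: v 0 j)
             - phi (x 0 j))).
  by apply/funext => h /=; rewrite !mxE.
split; first by rewrite /derivable E; exact: diff_derivable.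
rewrite /derive E -[LHS]/('D_(v 0 j) phi (x 0 j)) deriveE//.
rewrite -phi' deriveE// -[X in 'd _ _ X]mulr1.
by rewrite -[v 0 j * 1]/(v 0 j *: (1 : R)) linearZ.
Qed.

(* The shear metric is the one induced by the embedding with f' as above. *)
Lemma shear_metricE (R : realType) (B : R) (w f : R -> R) (x : 'rV[R]_3) :
  (forall s : R, is_derive s 1 f (shear_slope B w s)) ->
  induced_metric (shear_embedding B f) x = shear_metric B w x.
Proof.
move=> df; pose s := shear_slope B w (x 0 1).
have dB (j : 'I_3) : is_derive (x 0 j) 1 ( *%R B : R -> R) B.
  by apply: is_derive_eq; rewrite /GRing.scale/= mulr1.
have dshear (v : 'rV[R]_3) (k : 'I_6) :
    is_derive x v (fun z => shear_embedding B f z 0 k)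
    (nth 0 [:: v 0 1 * B; v 0 0 * B; v 0 1 * s; v 0 2%:R * B; 0; 0] k).
  case: k => -[|[|[|[|[|[|//]]]]]] kP /=.
  - rewrite (_ : (fun z => _) = (fun z : 'rV[R]_3 => B * z 0 1)); last first.
      by apply/funext => z; rewrite mxE.
    exact: (is_derive_coord v (dB 1)).
  - rewrite (_ : (fun z => _) = (fun z : 'rV[R]_3 => B * z 0 0)); last first.
      by apply/funext => z; rewrite mxE.
    exact: (is_derive_coord v (dB 0)).
  - rewrite (_ : (fun z => _) = (fun z : 'rV[R]_3 => f (z 0 1))); last first.
      by apply/funext => z; rewrite mxE.
    exact: (is_derive_coord v (df _)).
  - rewrite (_ : (fun z => _) = (fun z : 'rV[R]_3 => B * z 0 2%:R)); last first.
      by apply/funext => z; rewrite mxE.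
    exact: (is_derive_coord v (dB 2%:R)).
  - rewrite (_ : (fun z => _) = cst 0); last first.
      by apply/funext => z; rewrite mxE.
    exact: is_derive_cst.
  - rewrite (_ : (fun z => _) = cst 0); last first.
      by apply/funext => z; rewrite mxE.
    exact: is_derive_cst.
have pE (i : 'I_3) : partial i (shear_embedding B f) x =
    \row_k nth 0 [:: (i == 1)%:R * B; (i == 0)%:R * B; (i == 1)%:R * s;
                     (i == 2%:R)%:R * B; 0; 0] k.
  rewrite /partial derive_mx; last first.
    by apply/derivable_mxP => a k; rewrite (ord1 a); have [] := dshear (delta_mx 0 i) k.
  apply/rowP => k; rewrite !mxE.
  have [_ ->] := dshear (delta_mx 0 i) k.
  by rewrite !mxE !eqxx/= !(eq_sym i).
apply/matrixP => i j; rewrite !mxE /dotv !pE.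
rewrite !big_ord_recl big_ord0 !mxE /=.
case: i => -[|[|[|//]]] iP; case: j => -[|[|[|//]]] jP;
  by rewrite -!val_eqE /= /s ?(mul0r, mulr0, mul1r, addr0, add0r) ?expr2.
Qed.

(* Integral with respect to Lebesgue measure on R^3, the latter being built as a
   threefold product because the library has no Lebesgue measure on rows. *)
Definition row3 (R : realType) (q : R * R * R) : 'rV[R]_3 :=
  \row_i nth 0 [:: q.1.1; q.1.2; q.2] i.

Definition integral3 (R : realType) (A : set 'rV[R]_3) (h : 'rV[R]_3 -> R) :
    \bar R :=
  \int[((@lebesgue_measure R \x @lebesgue_measure R) \x @lebesgue_measure R)%E]_
     (q in @row3 R @^-1` A) (h (row3 q))%:E.

Definition energy (R : realType) (m : nat) (A : set 'rV[R]_3)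
    (y : 'rV[R]_3 -> 'rV[R]_m) : \bar R :=
  integral3 A (fun x => \sum_i dotv (partial i y x) (partial i y x)).

(* Continuity of t |-> y t on I with values in C^1_loc(A). *)
Definition continuous_in_C1loc (R : realType) (n m : nat) (I : set R)
    (A : set 'rV[R]_n) (y : R -> 'rV[R]_n -> 'rV[R]_m) : Prop :=
  forall t, I t -> forall K : set 'rV[R]_n, compact K -> K `<=` A ->
    {uniform K, y @ t --> y t} /\
    forall i, {uniform K, (fun s => partial i (y s)) @ t --> partial i (y t)}.

(* Main.v *)
Require Import Defs.
From mathcomp Require Import all_boot all_order all_algebra.
From mathcomp Require Import all_classical all_reals all_analysis.
From mathcomp Require Import measurable_realfun ring lra.
Import Order.TTheory GRing.Theory Num.Theory.
Import numFieldNormedType.Exports.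
Local Open Scope classical_set_scope.
Local Open Scope ring_scope.

(** Nash's twist, with the time [t] as a parameter.  A strictly short map is
    first obtained by shrinking [y_g].  If [xi, eta] are orthonormal normal
    fields along a map [y], adding
      [mu * (cos (nu . x / mu) a xi + sin (nu . x / mu) a eta)]
    with [mu] small changes the induced metric by [a ^ 2 nu (x) nu], up to a small
    error, changes [y] little in [C^0], and moves its first derivatives by
    [O(|a|)].  The metric deficit is a finite sum of such squares (approximately
    in the first stage, exactly in the later ones, where it is close to a
    multiple of the identity).  Repeating with deficits [k / 4 ^ q], the
    derivatives converge geometrically and the limit is isometric.

    To avoid any loss of derivatives, only [C^1] maps are used: the normal fields
    and amplitudes are merely continuous, and are replaced by [C^1]
    approximations before the twist is added.  The limit is an embedding because
    a lower Lipschitz bound is propagated through all the twists. *)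

(** * The Euclidean norm *)

(** Two normal fields are used because [cos] and [sin] along them give the derivative of the twist,
    up to small errors, the non-oscillating length [|a nu_i|]; this asks for [3 + 2 <= 6]. Each
    stage leaves a positive multiple of the identity unfilled: its error has no sign, and only this
    margin keeps the next deficit positive definite. Amplitudes are square roots of deficits, so
    quartering the deficit halves the steps of the derivatives.

    The obstacle to an embedding is that the derivatives change by an amount that is not small. The
    main part of the change is however normal to the map, and a normal displacement never shortens a
    vector; only error terms, as small as desired, are lost from the lower bounds.

    Time is harmless because only [x]-derivatives are taken. All constants, the wavelength [mu]
    included, come from compactness of one closed space-time cylinder and are thus uniform in [t].
    Joint continuity of the limit and of its [x]-derivatives on that cylinder gives continuity in
    [t] with values in [C^1]. *)

Section EuclideanNorm.
Context {R : realType} {m : nat}.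
Implicit Types a b c : 'rV[R]_m.

(** The norm [|a|] of a row is the largest absolute value of its entries, which suits entrywise
    estimates; orthogonality needs the Euclidean norm. [norm_le_enorm] and [enorm_le_norm] compare
    the two. *)
Definition enorm a : R := Num.sqrt (dotv a a).

Lemma dotvE a b : dotv a b = (a *m b^T) 0 0.
Proof. by rewrite /dotv mxE; apply: eq_bigr => k _; rewrite mxE. Qed.

Lemma dotvC a b : dotv a b = dotv b a.
Proof. by apply: eq_bigr => k _; rewrite mulrC. Qed.

Lemma dotvDl a b c : dotv (a + b) c = dotv a c + dotv b c.
Proof. by rewrite !dotvE mulmxDl mxE. Qed.

Lemma dotvZl k a b : dotv (k *: a) b = k * dotv a b.
Proof. by rewrite !dotvE -scalemxAl mxE. Qed.

Lemma dotvNl a b : dotv (- a) b = - dotv a b.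
Proof. by rewrite -scaleN1r dotvZl mulN1r. Qed.

Lemma dotvDr a b c : dotv a (b + c) = dotv a b + dotv a c.
Proof. by rewrite dotvC dotvDl !(dotvC a). Qed.

Lemma dotvZr k a b : dotv a (k *: b) = k * dotv a b.
Proof. by rewrite dotvC dotvZl dotvC. Qed.

Lemma dotvNr a b : dotv a (- b) = - dotv a b.
Proof. by rewrite dotvC dotvNl dotvC. Qed.

Lemma dotv0 a : dotv a 0 = 0.
Proof. by rewrite /dotv big1// => i _; rewrite mxE mulr0. Qed.

Lemma dotv_suml n (F : 'I_n -> 'rV[R]_m) a :
  dotv (\sum_i F i) a = \sum_i dotv (F i) a.
Proof.
elim/big_ind2 : _ => [|x1 x2 y1 y2 h1 h2|//]; first by rewrite dotvC dotv0.
by rewrite dotvDl h1 h2.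
Qed.

Lemma dotv_sumr n (F : 'I_n -> 'rV[R]_m) a :
  dotv a (\sum_i F i) = \sum_i dotv a (F i).
Proof. by rewrite dotvC dotv_suml; apply: eq_bigr => i _; rewrite dotvC. Qed.

Lemma dotv_ge0 a : 0 <= dotv a a.
Proof. by apply: sumr_ge0 => i _; rewrite -expr2 sqr_ge0. Qed.

Lemma dotv_eq0 a : (dotv a a == 0) = (a == 0).
Proof.
apply/idP/eqP => [|->]; last by rewrite dotv0.
rewrite psumr_eq0; last by move=> i _; rewrite -expr2 sqr_ge0.
move=> /allP h; apply/rowP => i; rewrite mxE; apply/eqP.
by have := h i (mem_index_enum _); rewrite /= mulf_eq0 orbb.
Qed.

Lemma enorm_ge0 a : 0 <= enorm a. Proof. exact: sqrtr_ge0. Qed.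

Lemma sqr_enorm a : enorm a ^+ 2 = dotv a a.
Proof. by rewrite sqr_sqrtr// dotv_ge0. Qed.

Lemma enorm_gt0 a : (0 < enorm a) = (a != 0).
Proof. by rewrite sqrtr_gt0 lt_def dotv_eq0 dotv_ge0 andbT. Qed.

Lemma enorm0 : enorm 0 = 0. Proof. by rewrite /enorm dotv0 sqrtr0. Qed.

Lemma enormZ k a : enorm (k *: a) = `|k| * enorm a.
Proof.
by rewrite /enorm dotvZl dotvZr mulrA -expr2 sqrtrM ?sqr_ge0// sqrtr_sqr.
Qed.

Lemma enormN a : enorm (- a) = enorm a.
Proof. by rewrite -scaleN1r enormZ normrN1 mul1r. Qed.

Lemma cauchy_schwarz a b : `|dotv a b| <= enorm a * enorm b.
Proof.
rewrite -(ler_pXn2r (_ : 0 < 2)%N) ?nnegrE ?mulr_ge0 ?enorm_ge0//.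
rewrite real_normK ?num_real// exprMn !sqr_enorm.
have [->|b0] := eqVneq b 0; first by rewrite !dotv0 expr0n/= mulr0.
have bb0 : 0 < dotv b b by rewrite lt_def dotv_eq0 b0 dotv_ge0.
(* The squared length of this vector is [dotv b b] times the Cauchy-Schwarz defect. *)
have := dotv_ge0 (dotv b b *: a - dotv a b *: b).
rewrite dotvDl !dotvDr dotvNl !dotvNr dotvNl !dotvZl !dotvZr (dotvC b a).
move=> h; have {}h : 0 <= dotv b b * (dotv a a * dotv b b - dotv a b ^+ 2).
  by apply: le_trans h _; rewrite le_eqVlt; apply/orP; left; apply/eqP; ring.
by rewrite pmulr_rge0// subr_ge0 in h.
Qed.

Lemma ler_enormD a b : enorm (a + b) <= enorm a + enorm b.
Proof.
rewrite -(ler_pXn2r (_ : 0 < 2)%N) ?nnegrE ?addr_ge0 ?enorm_ge0//.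
rewrite sqr_enorm sqrrD !sqr_enorm dotvDl !dotvDr (dotvC b a).
have := cauchy_schwarz a b; have := ler_norm (dotv a b); lra.
Qed.

Lemma ler_enormB a b : enorm (a - b) <= enorm a + enorm b.
Proof. by rewrite -(enormN b) ler_enormD. Qed.

Lemma ler_enorm_sub a b : enorm a - enorm b <= enorm (a - b).
Proof. by rewrite lerBlDr -{1}(subrK b a) ler_enormD. Qed.

Lemma ler_enorm_sum n (F : 'I_n -> 'rV[R]_m) :
  enorm (\sum_i F i) <= \sum_i enorm (F i).
Proof.
elim/big_ind2 : _ => [|x1 x2 y1 y2 h1 h2|//]; first by rewrite enorm0.
by rewrite (le_trans (ler_enormD _ _))// lerD.
Qed.

(** Used with [a] tangent and [b] normal to the map: this is why a twist costs a lower bound nothing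
    but its error terms. *)
Lemma enorm_sub_orthogonal a b : dotv a b = 0 -> enorm a <= enorm (a + b).
Proof.
move=> ab; rewrite ler_sqrt ?dotv_ge0//.
by rewrite dotvDl !dotvDr (dotvC b a) ab addr0 add0r lerDl dotv_ge0.
Qed.

Lemma norm_le_enorm a : `|a| <= enorm a.
Proof.
rewrite [leLHS]/Num.norm/= mx_normrE; apply: bigmax_le; first exact: enorm_ge0.
move=> [i k] _ /=; rewrite (ord1 i) -sqrtr_sqr ler_sqrt ?dotv_ge0// /dotv.
rewrite (bigD1 k)//= -expr2 lerDl sumr_ge0// => j _.
by rewrite -expr2 sqr_ge0.
Qed.

End EuclideanNorm.

Lemma ler_entry_norm {R : realType} {p q} (A : 'M[R]_(p, q)) i j :
  `|A i j| <= `|A|.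
Proof.
by rewrite [leRHS]/Num.norm/= mx_normrE; apply: (le_bigmax _ _ (i, j)).
Qed.

Lemma ler_norm_entries {R : realType} {p q} (A : 'M[R]_(p, q)) (e : R) :
  0 <= e -> (forall i j, `|A i j| <= e) -> `|A| <= e.
Proof.
move=> e0 h; rewrite [leLHS]/Num.norm/= mx_normrE.
by apply: bigmax_le => // -[i j] _; exact: h.
Qed.

Lemma enorm_le_norm {R : realType} {m} (a : 'rV[R]_m) : enorm a <= m%:R * `|a|.
Proof.
rewrite -(ler_pXn2r (_ : 0 < 2)%N) ?nnegrE ?mulr_ge0 ?enorm_ge0//.
rewrite sqr_enorm; have [->|a0] := eqVneq a 0.
  by rewrite dotv0 sqr_ge0.
have m0 : (1 : R) <= m%:R.
  by move: a a0; case: m => [|m] a; rewrite ?ler1n// (thinmx0 a) eqxx.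
apply: (@le_trans _ _ (\sum_(k < m) `|a| ^+ 2)).
  apply: ler_sum => k _; rewrite -expr2 -[leLHS]real_normK ?num_real//.
  by rewrite ler_sqr ?nnegrE// ler_entry_norm.
rewrite sumr_const card_ord -[leLHS]mulr_natl exprMn ler_wpM2r ?sqr_ge0//.
by rewrite expr2 ler_peMr.
Qed.

(** * Continuous and C^1 maps on a closed cylinder *)

Section ContinuityOnCylinder.
Context {R : realType} {n : nat}.
Local Notation Z := (R * 'rV[R]_n)%type.
Variable r : R.

(** The norm of a pair is a maximum, so this is a closed time interval times a closed cube: compact,
    star-shaped about the origin, and with convex time slices. *)
Definition cyl : set Z := [set z | `|z| <= r].

Definition contK {V : topologicalType} (f : Z -> V) :=
  forall z, cyl z -> f @ within cyl (nbhs z) --> f z.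

Lemma compact_cyl : compact cyl.
Proof.
have -> : cyl = `[- r, r]%classic `*`
    [set v : 'rV[R]_n | forall i, `[- r, r]%classic (v ord0 i)].
  apply/seteqP; split=> [[t x]|[t x] []] /=.
    rewrite /cyl /= prod_normE /= ge_max => /andP[tr xr]; split.
      by rewrite in_itv /= -ler_norml.
    by move=> i; rewrite in_itv /= -ler_norml (le_trans (ler_entry_norm _ _ _)).
  rewrite in_itv /= -ler_norml => tr xr; rewrite /cyl /= prod_normE /= ge_max tr /=.
  apply: ler_norm_entries => [|i j]; first exact: le_trans tr.
  by rewrite (ord1 i) ler_norml; have := xr j; rewrite in_itv.
apply: compact_setX; first exact: segment_compact.
exact: (@rV_compact R n (fun=> `[- r, r]%classic) (fun=> @segment_compact R _ _)).
Qed.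

Lemma contKP {V : topologicalType} (f : Z -> V) :
  contK f <-> {within cyl, continuous f}.
Proof. by split=> [h|/subspace_continuousP h]; [apply/subspace_continuousP|]. Qed.

Lemma continuous_contK {V : topologicalType} (f : Z -> V) :
  continuous f -> contK f.
Proof. by move=> cf z _; apply: cvg_within_filter; exact: cf. Qed.

Lemma contK_cst {V : topologicalType} (a : V) : contK (fun=> a).
Proof. by move=> z _; exact: cvg_cst. Qed.

Lemma contK_comp {V W : topologicalType} (f : Z -> V) (g : V -> W) :
  (forall z, cyl z -> {for f z, continuous g}) -> contK f ->
  contK (fun z => g (f z)).
Proof. by move=> cg cf z zK; apply: continuous_cvg; [exact: cg|exact: cf]. Qed.

Lemma contKD {V : normedModType R} (f g : Z -> V) :
  contK f -> contK g -> contK (fun z => f z + g z).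
Proof. by move=> cf cg z zK; apply: cvgD; [exact: cf|exact: cg]. Qed.

Lemma contKN {V : normedModType R} (f : Z -> V) :
  contK f -> contK (fun z => - f z).
Proof. by move=> cf z zK; apply: cvgN; exact: cf. Qed.

Lemma contKB {V : normedModType R} (f g : Z -> V) :
  contK f -> contK g -> contK (fun z => f z - g z).
Proof. by move=> cf cg; apply: contKD => //; exact: contKN. Qed.

Lemma contKZ {V : normedModType R} (f : Z -> R) (g : Z -> V) :
  contK f -> contK g -> contK (fun z => f z *: g z).
Proof. by move=> cf cg z zK; apply: cvgZ; [exact: cf|exact: cg]. Qed.

Lemma contKM (f g : Z -> R) : contK f -> contK g -> contK (fun z => f z * g z).
Proof. by move=> cf cg z zK; apply: cvgM; [exact: cf|exact: cg]. Qed.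

Lemma contKV (f : Z -> R) : (forall z, cyl z -> f z != 0) -> contK f ->
  contK (fun z => (f z)^-1).
Proof. by move=> f0 cf z zK; apply: cvgV; [exact: f0|exact: cf]. Qed.

Lemma contK_sqrt (f : Z -> R) : contK f -> contK (fun z => Num.sqrt (f z)).
Proof. by apply: contK_comp => z _; exact: sqrt_continuous. Qed.

Lemma contK_sum {V : normedModType R} (I : Type) (s : seq I) (P : pred I)
    (f : I -> Z -> V) :
  (forall i, contK (f i)) -> contK (fun z => \sum_(i <- s | P i) f i z).
Proof.
move=> cf; elim: s => [|i s ih].
  by under eq_fun do rewrite big_nil; exact: contK_cst.
under eq_fun do rewrite big_cons.
by case: (P i) => //; apply: contKD.
Qed.

Lemma contK_prod (I : Type) (s : seq I) (P : pred I) (f : I -> Z -> R) :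
  (forall i, contK (f i)) -> contK (fun z => \prod_(i <- s | P i) f i z).
Proof.
move=> cf; elim: s => [|i s ih].
  by under eq_fun do rewrite big_nil; exact: contK_cst.
under eq_fun do rewrite big_cons.
by case: (P i) => //; apply: contKM.
Qed.

Lemma contK_mxP {p q : nat} (A : Z -> 'M[R]_(p, q)) :
  contK A <-> forall i j, contK (fun z => A z i j).
Proof.
split=> [cA i j|cA z zK].
  apply: (contK_comp A (fun M : 'M[R]_(p, q) => M i j)) => // z _.
  exact: coord_continuous.
apply/cvgrPdist_le => e e0.
have h : forall ij : 'I_p * 'I_q,
    \forall z' \near within cyl (nbhs z), `|A z ij.1 ij.2 - A z' ij.1 ij.2| <= e.
  by move=> ij; have /cvgrPdist_le := cA ij.1 ij.2 z zK; apply.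
apply: filterS (filter_forall _ h) => z' H.
apply: ler_norm_entries => [|i j]; first exact: ltW.
by rewrite !mxE; exact: H (i, j).
Qed.

Lemma contK_mulmx {p q s : nat} (A : Z -> 'M[R]_(p, q)) (B : Z -> 'M[R]_(q, s)) :
  contK A -> contK B -> contK (fun z => A z *m B z).
Proof.
move=> /contK_mxP cA /contK_mxP cB; apply/contK_mxP => i j.
by under eq_fun do rewrite mxE; apply: contK_sum => k; apply: contKM.
Qed.

Lemma contK_trmx {p q : nat} (A : Z -> 'M[R]_(p, q)) :
  contK A -> contK (fun z => (A z)^T).
Proof.
move=> /contK_mxP cA; apply/contK_mxP => i j.
by under eq_fun do rewrite mxE; exact: cA.
Qed.

Lemma contK_det {p : nat} (A : Z -> 'M[R]_p) :
  contK A -> contK (fun z => \det (A z)).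
Proof.
move=> /contK_mxP cA; rewrite /determinant.
apply: contK_sum => s; apply: contKM; first exact: contK_cst.
by apply: contK_prod => i.
Qed.

(** Cramer's formula. It agrees with [invmx] only at invertible matrices, that is on the cylinder,
    which suffices for a limit taken within the cylinder. *)
Lemma contK_invmx {p : nat} (A : Z -> 'M[R]_p) :
  (forall z, cyl z -> A z \in unitmx) -> contK A ->
  contK (fun z => invmx (A z)).
Proof.
move=> uA cA z zK.
have h : contK (fun z => (\det (A z))^-1 *: \adj (A z)).
  apply: contKZ.
    by apply: contKV => [y /uA|]; [rewrite unitmxE unitfE|exact: contK_det].
  apply/contK_mxP => i j; under eq_fun do rewrite mxE.
  apply: contKM; first exact: contK_cst.
  apply: contK_det; apply/contK_mxP => k l; under eq_fun do rewrite !mxE.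
  exact: (contK_mxP A).1.
rewrite {2}/invmx (uA z zK); apply: cvg_trans (h z zK); apply: near_eq_cvg.
near=> y.
have Ky : cyl y by near: y; exact: withinT.
by rewrite /invmx uA.
Unshelve. all: by end_near. Qed.

Lemma contK_dotv {m : nat} (f g : Z -> 'rV[R]_m) :
  contK f -> contK g -> contK (fun z => dotv (f z) (g z)).
Proof.
move=> /contK_mxP cf /contK_mxP cg.
by apply: contK_sum => k; apply: contKM.
Qed.

Lemma contK_enorm {m : nat} (f : Z -> 'rV[R]_m) :
  contK f -> contK (fun z => enorm (f z)).
Proof. by move=> cf; apply: contK_sqrt; exact: contK_dotv. Qed.

Lemma cyl_scale (s : R) z : 0 <= s <= 1 -> cyl z -> cyl (s *: z).
Proof.
move=> /andP[s0 s1] zK; rewrite /cyl /= normrZ ger0_norm//.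
by rewrite (le_trans _ zK)// ler_piMl.
Qed.

Lemma contK_scale {V : topologicalType} (s : R) (f : Z -> V) : 0 <= s <= 1 ->
  contK f -> contK (fun z => f (s *: z)).
Proof.
move=> s01 cf z zK.
have h : (fun y : Z => s *: y) @ within cyl (nbhs z) -->
    within cyl (nbhs (s *: z)).
  move=> A; rewrite /within /= => H.
  have hs : {for z, continuous (fun y : Z => s *: y)} 
    by exact: (@scaler_continuous R Z s z).
  have H' : \forall y \near z, cyl (s *: y) -> A (s *: y) := hs _ H.
  change (\forall y \near z, cyl y -> A (s *: y)).
  by apply: filterS H' => y Ay yK; apply: Ay; exact: cyl_scale.
exact: cvg_comp h (cf _ (cyl_scale _ _ s01 zK)).
Qed.

(** Heine-Cantor through the near-covering form of compactness: around each [x], [P u] holds for all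
    nearby [z] and all small [u > 0], so one [u] serves the whole cylinder. *)
Lemma contK_unif {V : normedModType R} (f : Z -> V) : contK f ->
  forall e, 0 < e -> exists2 d, 0 < d & forall z z', cyl z -> cyl z' ->
    `|z - z'| < d -> `|f z - f z'| < e.
Proof.
move=> cf e e0.
pose P (d : R) z := forall z', cyl z' -> `|z - z'| < d -> `|f z - f z'| < e.
suff : \forall d \near 0^'+, cyl `<=` P d.
  move=> /nbhs_ballP[d /= d0 dP]; exists (d / 2); first by rewrite divr_gt0.
  move=> z z' zK z'K zz'; apply: (dP (d / 2)) => //=; last by rewrite divr_gt0.
  rewrite -ball_normE /= sub0r normrN gtr0_norm ?divr_gt0//.
  by rewrite ltr_pdivrMr// ltr_pMr// ltr1n.
apply: (near_covering_withinP _).2 => [|x xK].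
  exact/compact_near_coveringP/compact_cyl.
have /cvgrPdist_lt/(_ (e / 2)) := cf x xK; rewrite divr_gt0// => /(_ isT).
rewrite /within /= => /nbhs_ballP[d /= d0 dP].
exists (ball x (d / 2), [set u | 0 < u < d / 2]) => /=.
  split; first by apply: nbhsx_ballx; rewrite divr_gt0.
  by near=> u; apply/andP; split; near: u;
    [exact: nbhs_right_gt|apply: nbhs_right_lt; rewrite divr_gt0].
move=> [z u] /= [xz /andP[u0 ud]] zK z' z'K zz'.
rewrite -ball_normE /= in xz dP.
have h1 : `|f x - f z| < e / 2.
  by apply: dP => //=; rewrite (lt_trans xz)// ltr_pdivrMr// ltr_pMr// ltr1n.
have h2 : `|f x - f z'| < e / 2.
  apply: dP => //=; rewrite -(subrKA z) (le_lt_trans (ler_normD _ _))//.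
  by rewrite [ltRHS]splitr ltrD// (lt_trans zz').
rewrite -(subrKA (f x)) (le_lt_trans (ler_normD _ _))//.
by rewrite [ltRHS]splitr ltrD// distrC.
Unshelve. all: by end_near. Qed.

Lemma contK_bounded {V : normedModType R} (f : Z -> V) : contK f ->
  exists2 M, 0 < M & forall z, cyl z -> `|f z| <= M.
Proof.
move=> /contKP cf.
have /ex_strict_bound_gt0[M M0 MP] : bounded_set (f @` cyl).
  exact/compact_bounded/(continuous_compact cf)/compact_cyl.
by exists M => // z zK; apply/ltW/MP; exists z.
Qed.

End ContinuityOnCylinder.

Section C1OnCylinder.
Context {R : realType} {n : nat}.
Local Notation Z := (R * 'rV[R]_n)%type.
Variable r : R.

Definition dx {V : normedModType R} (i : 'I_n) (f : Z -> V) (z : Z) : V :=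
  partial i (fun x => f (z.1, x)) z.2.

(* Derivatives are taken in the second variable only; at points of the boundary
   of [cyl r] they still involve the values of [f] outside of [cyl r]. *)
Definition C1K {V : normedModType R} (f : Z -> V) : Prop :=
  [/\ forall z, cyl r z -> differentiable (fun x => f (z.1, x)) z.2,
      contK r f & forall i, contK r (dx i f)].

Lemma derivable_C1K {V : normedModType R} (f : Z -> V) z v :
  C1K f -> cyl r z -> derivable (fun x => f (z.1, x)) z.2 v.
Proof. by move=> [df _ _] zK; apply: diff_derivable; exact: df. Qed.

Lemma eq_contK {V : normedModType R} (f g : Z -> V) :
  (forall z, cyl r z -> f z = g z) -> contK r f -> contK r g.
Proof.
move=> fg cf z zK; rewrite -(fg _ zK); apply: cvg_trans (cf z zK).
apply: near_eq_cvg; near=> y; apply: fg.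
by near: y; exact: withinT.
Unshelve. all: by end_near. Qed.

Lemma dx_cst {V : normedModType R} (a : V) i z : dx i (fun=> a) z = 0.
Proof. exact: derive_cst. Qed.

Lemma C1K_cst {V : normedModType R} (a : V) : C1K (fun=> a).
Proof.
split=> [z _||i]; [exact: differentiable_cst|exact: contK_cst|].
by apply: (eq_contK (fun=> 0)) => [z _|]; [rewrite dx_cst|exact: contK_cst].
Qed.

Lemma dxD {V : normedModType R} (f g : Z -> V) i z : C1K f -> C1K g ->
  cyl r z -> dx i (fun z => f z + g z) z = dx i f z + dx i g z.
Proof.
by move=> cf cg zK; rewrite [LHS](@deriveD _ _ _ (fun x => f (z.1, x))
  (fun x => g (z.1, x)))//; exact: derivable_C1K.
Qed.

Lemma C1KD {V : normedModType R} (f g : Z -> V) :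
  C1K f -> C1K g -> C1K (fun z => f z + g z).
Proof.
move=> Cf Cg; have [df cf cdf] := Cf; have [dg cg cdg] := Cg; split.
- by move=> z zK; apply: differentiableD; [exact: df|exact: dg].
- exact: contKD.
- move=> i; apply: (eq_contK (fun z => dx i f z + dx i g z)); last exact: contKD.
  by move=> z zK; rewrite dxD.
Qed.

Lemma C1K_sum {V : normedModType R} (I : Type) (s : seq I) (f : I -> Z -> V) :
  (forall i, C1K (f i)) -> C1K (fun z => \sum_(i <- s) f i z).
Proof.
move=> cf; elim: s => [|i s ih].
  by under eq_fun do rewrite big_nil; exact: C1K_cst.
by under eq_fun do rewrite big_cons; exact: C1KD.
Qed.

Lemma dx_sum {V : normedModType R} (I : Type) (s : seq I) (f : I -> Z -> V) i z :
  (forall k, C1K (f k)) -> cyl r z ->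
  dx i (fun z => \sum_(k <- s) f k z) z = \sum_(k <- s) dx i (f k) z.
Proof.
move=> cf zK; elim: s => [|k s ih].
  by under eq_fun do rewrite big_nil; rewrite big_nil dx_cst.
under eq_fun do rewrite big_cons.
by rewrite (dxD _ _ _ _ (cf k) (C1K_sum _ _ _ cf) zK) ih big_cons.
Qed.

Lemma dxM (f g : Z -> R) i z : C1K f -> C1K g -> cyl r z ->
  dx i (fun z => f z * g z) z = f z * dx i g z + g z * dx i f z.
Proof.
case: z => t x cf cg zK; rewrite /dx /partial /=.
have -> : (fun x => f (t, x) * g (t, x)) =
  (fun x => f (t, x)) * (fun x => g (t, x)) by [].
by rewrite deriveM//; [have := derivable_C1K f _ _ cf zK; exact|
                       have := derivable_C1K g _ _ cg zK; exact].
Qed.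

Lemma C1KM (f g : Z -> R) : C1K f -> C1K g -> C1K (fun z => f z * g z).
Proof.
move=> Cf Cg; have [df cf cdf] := Cf; have [dg cg cdg] := Cg; split.
- by move=> z zK; apply: differentiableM; [exact: df|exact: dg].
- exact: contKM.
- move=> i; apply: (eq_contK (fun z => f z * dx i g z + g z * dx i f z)).
    by move=> z zK; rewrite dxM.
  by apply: contKD; apply: contKM.
Qed.

Lemma dxZl {V : normedModType R} (f : Z -> R) (a : V) i z : C1K f -> cyl r z ->
  dx i (fun z => f z *: a) z = dx i f z *: a.
Proof.
move=> [df _ _] zK; rewrite /dx /partial !deriveE; [|exact: df|].
  by rewrite (diffZl _ (df _ zK)).
by apply: differentiableZl; exact: df.
Qed.

Lemma C1KZl {V : normedModType R} (f : Z -> R) (a : V) :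
  C1K f -> C1K (fun z => f z *: a).
Proof.
move=> Cf; have [df cf cdf] := Cf; split.
- by move=> z zK; apply: differentiableZl; exact: df.
- by apply: contKZ => //; exact: contK_cst.
- move=> i; apply: (eq_contK (fun z => dx i f z *: a)).
    by move=> z zK; rewrite dxZl.
  by apply: contKZ => //; exact: contK_cst.
Qed.

Lemma dx_comp (phi : R -> R) (d : R) (f : Z -> R) i z : C1K f -> cyl r z ->
  is_derive (f z) 1 phi d -> dx i (fun z => phi (f z)) z = d * dx i f z.
Proof.
case: z => t x [df _ _] zK [dphi phi'].
have dp : differentiable phi (f (t, x)) by apply/derivable1_diffP.
have dfx := df _ zK; rewrite /= in dfx.
have dc := differentiable_comp dfx dp.
rewrite /dx /partial (deriveE _ dc) (deriveE _ dfx) (diff_comp dfx dp) /=.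
by rewrite deriv1E// derive1E phi' [LHS]mulrC.
Qed.

Lemma C1K_comp (phi dphi : R -> R) (f : Z -> R) :
  (forall z, cyl r z -> is_derive (f z) 1 phi (dphi (f z))) ->
  (forall z, cyl r z -> {for f z, continuous dphi}) ->
  C1K f -> C1K (fun z => phi (f z)).
Proof.
move=> dp cdp Cf; have [df cf cdf] := Cf; split.
- move=> [t x] zK; apply: (differentiable_comp (df _ zK)).
  by apply/derivable1_diffP; have [] := dp _ zK.
- apply: contK_comp => // z zK; apply: differentiable_continuous.
  by apply/derivable1_diffP; have [] := dp _ zK.
- move=> i; apply: (eq_contK (fun z => dphi (f z) * dx i f z)).
    by move=> z zK; have dpz := dp _ zK; rewrite (dx_comp phi (dphi (f z))).
  by apply: contKM => //; exact: contK_comp.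
Qed.

Lemma dx_coord (k : 'I_n) i z : dx i (fun z : Z => z.2 0 k) z = (i == k)%:R.
Proof.
rewrite /dx /partial /=.
have [_ ->] := is_derive_coord (delta_mx 0 i) (is_derive_id (z.2 0 k) (1 : R)).
by rewrite mulr1 mxE eqxx eq_sym.
Qed.

Lemma C1K_coord (k : 'I_n) : C1K (fun z => z.2 0 k).
Proof.
split=> [z _||i]; first exact: differentiable_coord.
- apply: continuous_contK => z.
  apply: (@continuous_comp _ _ _ (fun z : Z => z.2) (fun x : 'rV[R]_n => x 0 k)).
    exact: cvg_snd.
  exact: coord_continuous.
- apply: (@eq_contK R (fun=> (i == k)%:R)) => [z _|]; first by rewrite dx_coord.
  exact: contK_cst.
Qed.

Lemma C1K_time : C1K (fun z => z.1).
Proof.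
split=> [z _||i]; first exact: differentiable_cst.
- by apply: continuous_contK => z; exact: cvg_fst.
- apply: (@eq_contK R (fun=> 0)) => [z _|]; last exact: contK_cst.
  by rewrite /dx /partial/= derive_cst.
Qed.

Lemma dx_entry {m : nat} (y : Z -> 'rV[R]_m) k i z : C1K y -> cyl r z ->
  dx i (fun z => y z 0 k) z = dx i y z 0 k.
Proof.
move=> Cy zK; rewrite [in RHS]/dx /partial derive_mx ?mxE//.
exact: derivable_C1K.
Qed.

Lemma C1K_entry {m : nat} (y : Z -> 'rV[R]_m) k :
  C1K y -> C1K (fun z => y z 0 k).
Proof.
move=> Cy; have [dy cy cdy] := Cy; split.
- move=> z zK; apply: (differentiable_comp (g := fun v : 'rV[R]_m => v 0 k) (dy _ zK)).
  exact: differentiable_coord.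
- exact: (contK_mxP _ _).1.
- move=> i; apply: (eq_contK (fun z => dx i y z 0 k)).
    by move=> z zK; rewrite dx_entry.
  exact: (contK_mxP _ _).1.
Qed.

Lemma diff_rowE {V : normedModType R} (f : 'rV[R]_n -> V) x v :
  differentiable f x -> 'd f x v = \sum_i v 0 i *: partial i f x.
Proof.
move=> df; rewrite {1}(row_sum_delta v) linear_sum; apply: eq_bigr => i _.
by rewrite linearZ /= /partial deriveE.
Qed.

(** Time slices of the cylinder are convex, so the one-variable theorem applies along the segment
    from [x] to [x']. Scalar functions only: the intermediate point depends on the function. *)
Lemma C1K_mvt (f : Z -> R) t x x' : C1K f -> cyl r (t, x) -> cyl r (t, x') ->
  exists x'', [/\ cyl r (t, x''), `|x'' - x| <= `|x' - x| &
    f (t, x') - f (t, x) = \sum_i (x' - x) 0 i * dx i f (t, x'')].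
Proof.
move=> [df cf _] xK x'K; pose D : 'rV[R]_n := x' - x.
pose l (s : R) : 'rV[R]_n := x + s *: D.
have lK (s : R) : 0 <= s <= 1 -> cyl r (t, l s).
  move=> /andP[s0 s1]; move: xK x'K.
  rewrite /cyl /= !prod_normE /= !ge_max => /andP[-> xr] /andP[_ x'r] /=.
  have -> : l s = (1 - s) *: x + s *: x'.
    by rewrite /l /D scalerBr scalerBl scale1r addrA addrAC.
  rewrite (le_trans (ler_normD _ _))// !normrZ (ger0_norm s0) ger0_norm ?subr_ge0//.
  have -> : r = (1 - s) * r + s * r by ring.
  by rewrite lerD// ler_wpM2l// subr_ge0.
have dl (s : R) : 0 <= s <= 1 -> is_derive s (1 : R) (fun u : R => f (t, l u))
    (\sum_i D 0 i * dx i f (t, l s)).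
  move=> s01; have dfl := df _ (lK s s01).
  have ddl : is_diff s l (fun h => h *: D).
    have -> : (fun h : R => h *: D) = 0 + (fun h : R => h *: D).
      by apply/funext => h /=; rewrite [RHS]add0r.
    exact: is_diffD.
  have dl1 : differentiable l s by exact: ex_diff.
  have dc : differentiable (fun u => f (t, l u)) s.
    exact: (differentiable_comp (g := fun x => f (t, x)) dl1 dfl).
  split; first exact/derivable1_diffP.
  rewrite deriveE//.
  have -> := diff_comp (g := fun x => f (t, x)) dl1 dfl.
  by rewrite /= diff_val /= scale1r diff_rowE.
have [||c] := @MVT_segment R (fun u => f (t, l u))
    (fun s => \sum_i D 0 i * dx i f (t, l s)) 0 1 ler01.
- by move=> s s01; apply: dl; rewrite !ltW ?(itvP s01).
- apply: derivable_within_continuous => s; rewrite in_itv /= => s01.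
  by have [] := dl s s01.
rewrite in_itv /= => c01.
have -> : l 1 = x' by rewrite /l scale1r /D addrC subrK.
have -> : l 0 = x by rewrite /l scale0r addr0.
rewrite subr0 mulr1 => E.
exists (l c); split; [exact: lK| |exact: E].
have /andP[c0 c1] := c01.
by rewrite /l addrC addKr normrZ ger0_norm// ler_piMl.
Qed.

(** Each coordinate has its own intermediate point, which the maximum norm tolerates. The reference
    derivatives [L] are left free: zero gives a Lipschitz bound, the derivatives at [x] a
    first-order expansion, and those of a limit map or at the origin serve later. *)
Lemma C1K_mvt_estimate {m : nat} (y : Z -> 'rV[R]_m) t x x'
    (L : 'I_n -> 'rV[R]_m) w : 0 <= w ->
  C1K y -> cyl r (t, x) -> cyl r (t, x') ->
  (forall x'' i, cyl r (t, x'') -> `|x'' - x| <= `|x' - x| ->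
     `|dx i y (t, x'') - L i| <= w) ->
  `|y (t, x') - y (t, x) - \sum_i (x' - x) 0 i *: L i| <= n%:R * w * `|x' - x|.
Proof.
move=> w0 Cy xK x'K h.
apply: ler_norm_entries => [|a k]; first by rewrite !mulr_ge0.
rewrite (ord1 a).
have [x'' [x''K x''x E]] := C1K_mvt _ _ _ _ (C1K_entry _ k Cy) xK x'K.
rewrite !mxE E summxE -sumrB.
under eq_bigr do rewrite dx_entry// !mxE -mulrBr.
rewrite (le_trans (ler_norm_sum _ _ _))//.
apply: (@le_trans _ _ (\sum_(i < n) w * `|x' - x|)).
  apply: ler_sum => i _; rewrite normrM mulrC ler_pM//.
    by have := h x'' i x''K x''x; apply: le_trans;
       have := ler_entry_norm (dx i y (t, x'') - L i) 0 k; rewrite !mxE.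
  by have := ler_entry_norm (x' - x) 0 i; rewrite !mxE.
by rewrite sumr_const card_ord -[leLHS]mulr_natl mulrA.
Qed.

End C1OnCylinder.

(** * Partitions of unity and C^1 approximation *)

Lemma is_derive_of_quadratic_bound {R : realType} (phi : R -> R) (u d : R) :
  (forall h, `|phi (u + h) - phi u - d * h| <= h ^+ 2) -> is_derive u 1 phi d.
Proof.
move=> hphi.
have H : h^-1 *: (phi (h *: 1 + u) - phi u) @[h --> 0^'] --> d.
  apply/cvgrPdist_le => e e0; near=> h.
  have h0 : h != 0 by near: h; exact: nbhs_dnbhs_neq.
  have he : `|h| <= e.
    near: h; apply: nbhs_dnbhs; apply/nbhs_ballP; exists e => //= h.
    by rewrite -ball_normE /= sub0r normrN => /ltW.
  have -> : h *: (1 : R) = h by rewrite [LHS]mulr1.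
  rewrite -(@ler_pM2r _ `|h|) ?normr_gt0// -normrM.
  have -> : (d - h^-1 *: (phi (h + u) - phi u)) * h =
      - (phi (u + h) - phi u - d * h).
    by rewrite /GRing.scale/= (addrC h); field.
  rewrite normrN (le_trans (hphi h))// -[leLHS]real_normK ?num_real// expr2.
  by rewrite ler_wpM2r.
split; first by apply/cvg_ex; exists d.
exact/cvg_lim.
Unshelve. all: by end_near. Qed.

(** The squared positive part is [C^1], with derivative [u + |u|], which is all the regularity the
    bump functions need. *)
Definition sqr_pos {R : realType} (u : R) : R := Num.max 0 u ^+ 2.

Lemma is_derive_sqr_pos {R : realType} (u : R) :
  is_derive u 1 sqr_pos (u + `|u|).
Proof.
apply: is_derive_of_quadratic_bound => h; rewrite ler_norml /sqr_pos.
by have [] := leP 0 u => hu; rewrite ?(ger0_norm hu) ?(ltr0_norm hu);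
  have [] := leP 0 (u + h) => hh; apply/andP; split; nra.
Qed.

Section PartitionOfUnity.
Context {R : realType} {n : nat}.
Local Notation Z := (R * 'rV[R]_n)%type.
Variable r : R.

Lemma C1KV (f : Z -> R) : (forall z, cyl r z -> f z != 0) ->
  C1K r f -> C1K r (fun z => (f z)^-1).
Proof.
move=> f0; apply: (@C1K_comp _ _ _ (fun x => x^-1) (fun x => - (x ^+ 2)^-1)) => z zK.
  have fz := f0 z zK; split; first exact: derivableV.
  by rewrite deriveV// derive_id /GRing.scale/= mulr1.
apply: cvgN; apply: cvgV; first by rewrite expf_neq0// f0.
exact: exprn_continuous.
Qed.

(** The squared Euclidean distance in space-time; unlike the maximum norm it is differentiable. *)
Definition sqdist (c z : Z) : R :=
  (z.1 - c.1) * (z.1 - c.1)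
  + \sum_i (z.2 0 i - c.2 0 i) * (z.2 0 i - c.2 0 i).

Lemma C1K_sqdist c : C1K r (sqdist c).
Proof.
have C1Kt : C1K r (fun z : Z => z.1 - c.1).
  by apply: C1KD; [exact: C1K_time|exact: C1K_cst].
have C1Kx i : C1K r (fun z : Z => z.2 0 i - c.2 0 i).
  by apply: C1KD; [exact: C1K_coord|exact: C1K_cst].
have h1 := C1KM _ _ _ C1Kt C1Kt.
have h2 i := C1KM _ _ _ (C1Kx i) (C1Kx i).
exact: C1KD _ _ _ h1 (C1K_sum _ _ _ _ h2).
Qed.

Lemma sqdist_ge c z : `|z - c| ^+ 2 <= sqdist c z.
Proof.
have sqx i : 0 <= (z.2 0 i - c.2 0 i) * (z.2 0 i - c.2 0 i).
  by rewrite -expr2 sqr_ge0.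
rewrite prod_normE /= /Num.max; case: ifP => _.
  apply: (@le_trans _ _ (enorm (z.2 - c.2) ^+ 2)).
    by rewrite ler_sqr ?nnegrE ?enorm_ge0// norm_le_enorm.
  rewrite sqr_enorm /dotv; under eq_bigr do rewrite !mxE.
  by rewrite lerDr -expr2 sqr_ge0.
by rewrite real_normK ?num_real// expr2 lerDl sumr_ge0.
Qed.

Lemma sqdist_le c z : sqdist c z <= n.+1%:R * `|z - c| ^+ 2.
Proof.
have [h1 h2] : `|z.1 - c.1| <= `|z - c| /\ `|z.2 - c.2| <= `|z - c|.
  by rewrite prod_normE /= !num_le_max !lexx orbT.
have sq (a : R) : `|a| <= `|z - c| -> a * a <= `|z - c| ^+ 2.
  by move=> h; rewrite -expr2 -real_normK ?num_real// ler_sqr ?nnegrE.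
rewrite -add1n natrD mulrDl mul1r; apply: lerD; first exact: sq.
apply: (@le_trans _ _ (\sum_(i < n) `|z - c| ^+ 2)).
  apply: ler_sum => i _; apply/sq/(le_trans _ h2).
  by have := ler_entry_norm (z.2 - c.2) 0 i; rewrite !mxE.
by rewrite sumr_const card_ord mulr_natl.
Qed.

(** Near-covering compactness, with the finite lists of centres ordered by inclusion as index
    filter. Centres outside the cylinder are discarded at the end. *)
Lemma cyl_finite_cover (d : R) : 0 < d ->
  exists s : seq Z, (forall c, c \in s -> cyl r c) /\
    forall z, cyl r z -> exists2 c, c \in s & `|z - c| < d.
Proof.
move=> d0; pose F : set_system (seq Z) :=
  filter_from setT (fun s0 : seq Z => [set s : seq Z | {subset s0 <= s}]).
have FF : Filter F.
  apply: filter_from_filter; first by exists [::].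
  move=> s1 s2 _ _; exists (s1 ++ s2) => // s /= ss.
  by split=> c cs; apply: ss; rewrite mem_cat cs ?orbT.
have := (near_covering_withinP _).2
  ((compact_near_coveringP _).1 (@compact_cyl R n r)).
move=> /(_ _ F (fun s z => exists c, [/\ c \in s, cyl r c & `|z - c| < d]) FF).
case=> [x xK|s0 _ /(_ s0 (fun _ => id)) cov].
  exists (ball x d, [set s : seq Z | {subset [:: (x : Z)] <= s}]) => /=.
    by split; [exact: nbhsx_ballx|exists [:: x]].
  move=> [z s] /= [+ xs] _; rewrite -ball_normE /= => xz.
  by exists x; split; [apply: xs; rewrite inE| |rewrite distrC].
exists [seq c <- s0 | `|c| <= r]; split=> [c|z /cov[c [cs cK zc]]].
  by rewrite mem_filter => /andP[].
by exists c => //; rewrite mem_filter cs andbT.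
Qed.

Lemma partition_of_unity (rho : R) : 0 < rho ->
  exists (s : seq Z) (phi : Z -> Z -> R),
    [/\ forall c, c \in s -> cyl r c, forall c, C1K r (phi c),
        forall c z, cyl r z -> 0 <= phi c z,
        forall z, cyl r z -> \sum_(c <- s) phi c z = 1 &
        forall c z, cyl r z -> phi c z != 0 -> `|z - c| < rho].
Proof.
(* A point within [d] of a centre in the maximum norm has [sqdist] below
   [n.+1%:R * d ^+ 2 <= rho ^+ 2], so the bump at that centre is positive there. *)
move=> rho0; pose d := rho / n.+1%:R.
have d0 : 0 < d by rewrite divr_gt0.
have [s [sK cov]] := cyl_finite_cover _ d0.
pose psi c z := sqr_pos (rho ^+ 2 - sqdist c z).
have psi_ge0 c z : 0 <= psi c z by exact: sqr_ge0.
have Cpsi c : C1K r (psi c).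
  apply: (@C1K_comp _ _ _ sqr_pos (fun u => u + `|u|)).
  - by move=> z _; exact: is_derive_sqr_pos.
  - by move=> z _; apply: cvgD; [exact: cvg_id|exact: norm_continuous].
  - apply: C1KD; first exact: C1K_cst.
    under eq_fun do rewrite -mulN1r.
    by apply: C1KM; [exact: C1K_cst|exact: C1K_sqdist].
pose S z := \sum_(c <- s) psi c z.
have S0 z : cyl r z -> S z != 0.
  move=> zK; have [c /= cD cz] := cov z zK.
  suff : 0 < S z by move/lt0r_neq0.
  rewrite /S (big_rem c)//= ltr_pwDl ?sumr_ge0//.
  rewrite /psi /sqr_pos exprn_gt0// lt_max subr_gt0 orbC.
  apply/orP; left; apply: le_lt_trans (sqdist_le _ _) _.
  have : `|z - c| ^+ 2 < d ^+ 2 by rewrite ltr_sqr ?nnegrE// ltW.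
  rewrite -(@ltr_pM2l _ n.+1%:R)// => /lt_le_trans; apply.
  rewrite /d expr_div_n mulrCA expr2 -[leRHS]mulr1 ler_wpM2l ?sqr_ge0//.
  by rewrite invfM mulrA divff// mul1r invf_le1// ler1n.
exists s, (fun c z => psi c z * (S z)^-1); split.
- exact: sK.
- by move=> c; apply: C1KM => //; apply: C1KV => //; exact: C1K_sum.
- by move=> c z zK; rewrite mulr_ge0// invr_ge0 sumr_ge0.
- by move=> z zK; rewrite -mulr_suml divff// S0.
- move=> c z zK; rewrite mulf_eq0 negb_or => /andP[+ _].
  rewrite /psi /sqr_pos sqrf_eq0.
  have [_|+ _] := leP (rho ^+ 2 - sqdist c z) 0; first by rewrite eqxx.
  rewrite subr_gt0 => /(le_lt_trans (sqdist_ge c z)).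
  by rewrite ltr_sqr ?nnegrE// ltW.
Qed.

(** The approximant is kept as an explicit nonnegative combination of sampled values [f c], because
    the first stage decomposes each sampled matrix separately. *)
Lemma approx_by_partition {V : normedModType R} (f : Z -> V) (e : R) :
  contK r f -> 0 < e ->
  exists (s : seq Z) (phi : Z -> Z -> R),
    [/\ forall c, c \in s -> cyl r c, forall c, C1K r (phi c),
        forall c z, cyl r z -> 0 <= phi c z &
        forall z, cyl r z -> `|f z - \sum_(c <- s) phi c z *: f c| <= e].
Proof.
move=> cf e0; have [d d0 dP] := contK_unif _ _ cf _ e0.
have [s [phi [sK Cphi phi0 phi1 phid]]] := partition_of_unity _ d0.
exists s, phi; split => // z zK.
rewrite -[X in `|X - _|]scale1r -(phi1 z zK) scaler_suml -sumrB.
rewrite (le_trans (ler_norm_sum _ _ _))//.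
apply: (@le_trans _ _ (\sum_(c <- s) phi c z * e)); last first.
  by rewrite -mulr_suml phi1// mul1r.
rewrite big_seq [leRHS]big_seq; apply: ler_sum => c cs.
rewrite -scalerBr normrZ ger0_norm ?phi0//.
have [->|pc] := eqVneq (phi c z) 0; first by rewrite !mul0r.
rewrite ler_wpM2l ?phi0// ltW//.
by apply: dP => //; [exact: sK|exact: phid].
Qed.

Lemma approx_C1K {V : normedModType R} (f : Z -> V) (e : R) :
  contK r f -> 0 < e ->
  exists2 g, C1K r g & forall z, cyl r z -> `|f z - g z| <= e.
Proof.
move=> cf e0; have [s [phi [_ Cphi _ fphi]]] := approx_by_partition _ _ cf e0.
by eexists; [|exact: fphi]; apply: C1K_sum => c; exact: C1KZl.
Qed.

End PartitionOfUnity.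

Lemma ler_norm_mulmx {R : realType} {p q s} (A : 'M[R]_(p, q)) (B : 'M[R]_(q, s)) :
  `|A *m B| <= q%:R * `|A| * `|B|.
Proof.
apply: ler_norm_entries => [|i j]; first by rewrite !mulr_ge0.
rewrite mxE (le_trans (ler_norm_sum _ _ _))//.
apply: (@le_trans _ _ (\sum_(k < q) `|A| * `|B|)).
  by apply: ler_sum => k _; rewrite normrM ler_pM// ler_entry_norm.
by rewrite sumr_const card_ord -[leLHS]mulr_natl mulrA.
Qed.

(** * Normal frames *)

Section NormalFrame.
Context {R : realType} {n m : nat}.
Local Notation Z := (R * 'rV[R]_n)%type.
Variable r : R.
Variable p : nat.
Variable V : Z -> 'M[R]_(p, m).
Hypothesis V_cont : contK r V.
Hypothesis V_unit : forall z, cyl r z -> V z *m (V z)^T \in unitmx.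

(** The orthogonal projector onto the complement of the row space of [V z], acting on rows from the
    right. *)
Let N z : 'M[R]_m := 1%:M - (V z)^T *m invmx (V z *m (V z)^T) *m V z.

Let N_cont : contK r N.
Proof.
apply: contKB; first exact: contK_cst.
have cVT := contK_trmx _ _ V_cont.
have cG := contK_invmx _ _ V_unit (contK_mulmx _ _ _ V_cont cVT).
exact: contK_mulmx _ _ _ (contK_mulmx _ _ _ cVT cG) V_cont.
Qed.

Let N_normal z : cyl r z -> N z *m (V z)^T = 0.
Proof.
move=> zK; rewrite mulmxBl mul1mx -!mulmxA mulVmx ?V_unit// mulmx1.
exact: subrr.
Qed.

Let N_id k z (u : 'M[R]_(k, m)) : u *m (V z)^T = 0 -> u *m N z = u.
Proof. by move=> uV; rewrite mulmxBr mulmx1 !mulmxA uV !mul0mx subr0. Qed.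

Lemma normal_rows (A : 'M[R]_(p, m)) k : (p + k <= m)%N ->
  exists F : 'M[R]_(k, m), row_free F /\ F *m A^T = 0.
Proof.
move=> pkm; pose C := kermx A^T.
have rC : (k <= \rank C)%N.
  rewrite mxrank_ker leq_subRL ?rank_leq_row//.
  by rewrite (leq_trans _ pkm)// leq_add2r rank_leq_col.
exists (pid_mx k *m row_base C); split; last first.
  by apply/eqP; rewrite -mulmxA; have /sub_kermxP -> : (row_base C <= C)%MS;
    rewrite ?mulmx0// eq_row_base.
by rewrite /row_free mxrankMfree ?row_base_free// rank_pid_mx.
Qed.

(* The normal bundle over the star-shaped set [cyl r] is trivialised by
   transporting a frame along the rays [s *: z], projecting it orthogonally onto
   the normal spaces at sufficiently many intermediate points. *)
Lemma normal_frame k : (p + k <= m)%N ->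
  exists F : Z -> 'M[R]_(k, m), contK r F /\
    forall z, cyl r z -> row_free (F z) /\ F z *m (V z)^T = 0.
Proof.
move=> pkm; have [F0 [F0free F0V]] := normal_rows (V 0) _ pkm.
have m10 : 0 < (m.+1%:R : R)^-1 by rewrite invr_gt0.
have [d d0 dN] := contK_unif _ _ N_cont _ m10.
pose M := (Num.truncn (r / d)).+1.
have rM : r / M%:R < d.
  by rewrite ltr_pdivrMr// mulrC -ltr_pdivrMr// truncnS_gt.
have M01 j : (j <= M)%N -> 0 <= j%:R / M%:R <= (1 : R).
  by move=> jM; rewrite divr_ge0//= ler_pdivrMr// mul1r ler_nat.
pose F := fix F j z : 'M[R]_(k, m) := if j is j'.+1 then
  F j' z *m N ((j%:R / M%:R) *: z) else F0.
have F_cont j : (j <= M)%N -> contK r (F j).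
  elim: j => [_|j ih jM]; first exact: contK_cst.
  apply: contK_mulmx; first exact/ih/ltnW.
  by apply: contK_scale => //; exact: M01.
exists (F M); split=> [|z zK]; first exact: F_cont.
suff H j : (j <= M)%N ->
    row_free (F j z) /\ F j z *m (V ((j%:R / M%:R) *: z))^T = 0.
  by have := H M (leqnn _); rewrite divff ?pnatr_eq0// scale1r.
elim: j => [_|j ih jM]; first by rewrite mul0r scale0r.
have {ih}[fj Vj] := ih (ltnW jM).
have zjK : cyl r ((j%:R / M%:R) *: z) by apply: cyl_scale => //; exact/M01/ltnW.
have zSK : cyl r ((j.+1%:R / M%:R) *: z) by apply: cyl_scale => //; exact: M01.
split; last by rewrite /= -mulmxA N_normal ?mulmx0.
apply: inj_row_free => u; rewrite /= mulmxA => u0.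
set w := u *m F j z in u0.
have wN : w *m N ((j%:R / M%:R) *: z) = w by apply: N_id; rewrite -mulmxA Vj mulmx0.
(* [w] is fixed by the projector at step [j] and killed by the one at step [j.+1]. Their difference
   is below [m.+1%:R^-1], so [w != 0] would give [|w| < |w|]: independence survives each
   projection. *)
have w0 : w = 0.
  apply/eqP/negPn/negP => w0.
  have : `|w| <= m%:R * `|w| * `|N ((j%:R / M%:R) *: z) - N ((j.+1%:R / M%:R) *: z)|.
    by rewrite -[in leLHS]wN -[X in `|X|]subr0 -u0 -mulmxBr ler_norm_mulmx.
  apply/negP; rewrite -ltNge mulrAC -[ltRHS]mul1r ltr_pM2r ?normr_gt0//.
  have zz : `|(j%:R / M%:R) *: z - (j.+1%:R / M%:R) *: z| < d.
    rewrite -scalerBl -mulrBl normrZ normrM distrC -natrB// subSnn normr1 mul1r.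
    rewrite ger0_norm// (le_lt_trans _ rM)// mulrC ler_wpM2r//.
  have h := dN _ _ zjK zSK zz.
  apply: (@le_lt_trans _ _ (m%:R * m.+1%:R^-1)); first by rewrite ler_wpM2l// ltW.
  by rewrite ltr_pdivrMr// mul1r ltr_nat.
rewrite -(mul0mx _ (F j z)) in w0.
exact: (row_free_inj fj).
Qed.

Hypothesis pm : (p + 2 <= m)%N.

(** Gram-Schmidt applied to a normal frame of two rows. Independence of the rows keeps both
    normalising factors nonzero, hence the result continuous. *)
Lemma orthonormal_normal_frame : exists xi eta : Z -> 'rV[R]_m,
  [/\ contK r xi, contK r eta &
    forall z, cyl r z -> [/\ dotv (xi z) (xi z) = 1, dotv (eta z) (eta z) = 1,
      dotv (xi z) (eta z) = 0 &
      forall i, dotv (row i (V z)) (xi z) = 0 /\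
                dotv (row i (V z)) (eta z) = 0]].
Proof.
have [F [cF FP]] := normal_frame _ pm.
have crow i : contK r (fun z => row i (F z)).
  apply/contK_mxP => a k; under eq_fun do rewrite mxE.
  exact: (contK_mxP _ _).1.
have FV z i : cyl r z -> forall j, dotv (row j (V z)) (row i (F z)) = 0.
  move=> zK j; have [_ /matrixP/(_ i j)] := FP z zK; rewrite !mxE => <-.
  by apply: eq_bigr => k _; rewrite !mxE mulrC.
pose f1 z := row 0 (F z); pose f2 z := row 1 (F z).
have cf1 : contK r f1 by exact: crow.
have cf2 : contK r f2 by exact: crow.
have fun1 z : cyl r z -> forall a b, a *: f1 z + b *: f2 z = 0 -> a = 0 /\ b = 0.
  move=> zK a b ab0; have [Ff _] := FP z zK.
  pose u : 'rV[R]_2 := \row_j (if j == 0 then a else b).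
  have : u *m F z = 0.
    rewrite mulmx_sum_row !big_ord_recl big_ord0 addr0 !mxE /= -[RHS]ab0.
    by congr (_ + _ *: row _ _); apply/val_inj.
  rewrite -(mul0mx _ (F z)) => /(row_free_inj Ff)/rowP u0.
  by have := u0 0; have := u0 1; rewrite !mxE.
have f10 z : cyl r z -> f1 z != 0.
  move=> zK; apply/eqP => h; have [] := fun1 z zK 1 0.
    by rewrite h scaler0 scale0r addr0.
  by move/eqP; rewrite oner_eq0.
pose xi z := (enorm (f1 z))^-1 *: f1 z.
have cxi : contK r xi.
  apply: (contKZ _ _ _ _ cf1); apply: (contKV _ _ _ (contK_enorm _ _ cf1)).
  by move=> z zK; rewrite gt_eqF// enorm_gt0 f10.
pose h z := f2 z - dotv (f2 z) (xi z) *: xi z.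
have ch : contK r h.
  exact: contKB _ _ _ cf2 (contKZ _ _ _ (contK_dotv _ _ _ cf2 cxi) cxi).
have h0 z : cyl r z -> h z != 0.
  move=> zK; apply/eqP => hz.
  have [] := fun1 z zK (- (dotv (f2 z) (xi z) * (enorm (f1 z))^-1)) 1.
    by rewrite scale1r addrC scaleNr -scalerA; exact: hz.
  by move=> _ /eqP; rewrite oner_eq0.
have unit1 (v : 'rV[R]_m) : v != 0 ->
    dotv ((enorm v)^-1 *: v) ((enorm v)^-1 *: v) = 1.
  move=> v0; rewrite dotvZl dotvZr -sqr_enorm mulrA -expr2 -exprMn mulVf ?expr1n//.
  by rewrite gt_eqF// enorm_gt0.
have xixi z : cyl r z -> dotv (xi z) (xi z) = 1 by move=> zK; exact/unit1/f10.
have ceta : contK r (fun z => (enorm (h z))^-1 *: h z).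
  apply: (contKZ _ _ _ _ ch); apply: (contKV _ _ _ (contK_enorm _ _ ch)).
  by move=> z zK; rewrite gt_eqF// enorm_gt0 h0.
exists xi, (fun z => (enorm (h z))^-1 *: h z); split; [exact: cxi|exact: ceta|].
move=> z zK; split; [exact: xixi|exact/unit1/h0| |].
  rewrite dotvZr dotvDr dotvNr dotvZr xixi// mulr1 (dotvC (xi z)).
  by rewrite subrr mulr0.
move=> i; have xi0 : dotv (row i (V z)) (xi z) = 0 by rewrite dotvZr FV// mulr0.
by rewrite xi0 dotvZr dotvDr dotvNr dotvZr xi0 FV// mulr0 subr0 mulr0.
Qed.

End NormalFrame.

(** * Uniform first-order estimates for row-valued maps *)

Section Estimates.
Context {R : realType} {n m : nat}.
Local Notation Z := (R * 'rV[R]_n)%type.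
Variable r : R.

Lemma C1KZ (f : Z -> R) (y : Z -> 'rV[R]_m) :
  C1K r f -> C1K r y -> C1K r (fun z => f z *: y z).
Proof.
move=> Cf Cy.
have -> : (fun z => f z *: y z) =
    (fun z => \sum_k (f z * y z 0 k) *: delta_mx 0 k).
  apply/funext => z; rewrite {1}(row_sum_delta (y z)) scaler_sumr.
  by apply: eq_bigr => k _; rewrite scalerA.
have h k := C1KM _ _ _ Cf (C1K_entry _ _ k Cy).
exact: C1K_sum _ _ _ _ (fun k => C1KZl _ _ _ (h k)).
Qed.

Lemma dxZ (f : Z -> R) (y : Z -> 'rV[R]_m) i z : C1K r f -> C1K r y ->
  cyl r z -> dx i (fun z => f z *: y z) z = f z *: dx i y z + dx i f z *: y z.
Proof.
move=> Cf Cy zK; apply/rowP => k.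
rewrite -(dx_entry _ _ _ _ _ (C1KZ _ _ Cf Cy) zK).
have -> : (fun z => (f z *: y z) 0 k) = (fun z => f z * y z 0 k).
  by apply/funext => ?; rewrite mxE.
rewrite (dxM _ _ _ _ _ Cf (C1K_entry _ _ k Cy) zK) (dx_entry _ _ _ _ _ Cy zK).
by rewrite !mxE (mulrC (y z 0 k)).
Qed.

Lemma contK_enorm_bounded (I : finType) (y : I -> Z -> 'rV[R]_m) :
  (forall i, contK r (y i)) ->
  exists2 M, 0 < M & forall i z, cyl r z -> enorm (y i z) <= M.
Proof.
move=> cy; have h i := contK_enorm _ _ (cy i).
have [M M0 MP] := contK_bounded _ _ (contK_sum r _ (index_enum I) predT _ h).
exists M => // i z zK; apply: le_trans (MP z zK).
rewrite ger0_norm ?sumr_ge0// => [|j _]; last exact: enorm_ge0.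
by rewrite (bigD1 i)//= lerDl sumr_ge0// => j _; exact: enorm_ge0.
Qed.

Lemma C1K_lipschitz (y : Z -> 'rV[R]_m) : C1K r y ->
  exists2 C, 0 < C & forall t x x', cyl r (t, x) -> cyl r (t, x') ->
    enorm (y (t, x) - y (t, x')) <= C * `|x - x'|.
Proof.
move=> Cy; have [_ _ cdy] := Cy.
have [C C0 CP] := contK_enorm_bounded _ _ cdy.
exists (m%:R * (n%:R * C) + 1) => [|t x x' xK x'K].
  by rewrite ltr_wpDl// !mulr_ge0// ltW.
have := C1K_mvt_estimate _ _ _ _ _ (fun=> 0) _ (ltW C0) Cy x'K xK.
rewrite big1 => [|i _]; last by rewrite scaler0.
rewrite subr0 => h.
rewrite (le_trans (enorm_le_norm _))// mulrDl mul1r ler_wpDr// -mulrA ler_wpM2l//.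
apply: h => x'' i x''K _; rewrite subr0.
exact: le_trans (norm_le_enorm _) (CP _ _ x''K).
Qed.

(** Uniform continuity of the derivatives makes [rho] independent of the base point. This [rho] is
    the scale that separates near pairs from far ones in [corrugation_expanding]. *)
Lemma C1K_uniform_diff (y : Z -> 'rV[R]_m) (e : R) : C1K r y -> 0 < e ->
  exists2 rho, 0 < rho & forall t x x', cyl r (t, x) -> cyl r (t, x') ->
    `|x - x'| < rho ->
    enorm (y (t, x) - y (t, x') - \sum_i (x - x') 0 i *: dx i y (t, x'))
      <= e * `|x - x'|.
Proof.
move=> Cy e0; have [_ _ cdy] := Cy.
pose w := e / (m.+1%:R * n.+1%:R).
have w0 : 0 < w by rewrite divr_gt0// mulr_gt0.
have cV : contK r (fun z => \matrix_i dx i y z).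
  apply/contK_mxP => i k; under eq_fun do rewrite mxE.
  exact: (contK_mxP _ _).1 (cdy i) 0 k.
have [rho rho0 rhoP] := contK_unif _ _ cV _ w0.
exists rho => // t x x' xK x'K xx'.
have := C1K_mvt_estimate _ _ _ _ _ (fun i => dx i y (t, x')) _ (ltW w0) Cy x'K xK.
move=> h; apply: le_trans (enorm_le_norm _) _.
apply: (@le_trans _ _ (m%:R * (n%:R * w * `|x - x'|))).
  rewrite ler_wpM2l//; apply: h => x'' i x''K x''x.
  have : `|(t, x'') - (t, x')| < rho.
    by rewrite prod_normE /= subrr normr0 gt_max rho0 (le_lt_trans x''x).
  move=> /(rhoP _ _ x''K x'K)/ltW; apply: le_trans.
  apply: ler_norm_entries => // a k; rewrite (ord1 a).
  have := ler_entry_norm (\matrix_i dx i y (t, x'') - \matrix_i dx i y (t, x')) i k.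
  by rewrite !mxE.
rewrite !mulrA ler_wpM2r// ler_pdivrMr ?mulr_gt0//.
by rewrite mulrC ler_wpM2l ?(ltW e0)// ler_pM// ler_nat.
Qed.

End Estimates.

Lemma ler_dist_cos {R : realType} (a b : R) : `|cos a - cos b| <= `|a - b|.
Proof.
wlog ab : a b / b <= a.
  by move=> h; have [/h//|/ltW/h] := leP b a; rewrite distrC [leRHS]distrC.
have cf : {within `[b, a], continuous (@cos R)}.
  by apply: continuous_subspaceT => x; exact: continuous_cos.
have [c _ ->] := MVT_segment ab (fun x _ => is_derive_cos x) cf.
by rewrite normrM ler_piMl// normrN ler_norml sin_geN1 sin_le1.
Qed.

Lemma ler_dist_sin {R : realType} (a b : R) : `|sin a - sin b| <= `|a - b|.
Proof.
wlog ab : a b / b <= a.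
  by move=> h; have [/h//|/ltW/h] := leP b a; rewrite distrC [leRHS]distrC.
have cf : {within `[b, a], continuous (@sin R)}.
  by apply: continuous_subspaceT => x; exact: continuous_sin.
have [c _ ->] := MVT_segment ab (fun x _ => is_derive_sin x) cf.
by rewrite normrM ler_piMl// ler_norml cos_geN1 cos_le1.
Qed.

(** The letters [d], [n], [e] stand for old derivative, normal twist and error. Products of [d] with
    [n] vanish; the four products with one error cost [M * e] each, and the product of two errors
    costs at most [e] because [e <= 1]. *)
Lemma metric_perturbation {R : realType} {m} (di dj ni nj ei ej : 'rV[R]_m)
    (M e : R) : 0 <= e <= 1 ->
  dotv di nj = 0 -> dotv dj ni = 0 ->
  enorm di <= M -> enorm dj <= M -> enorm ni <= M -> enorm nj <= M ->
  enorm ei <= e -> enorm ej <= e ->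
  `|dotv (di + ni + ei) (dj + nj + ej) - dotv di dj - dotv ni nj|
     <= (4 * M + 1) * e.
Proof.
move=> /andP[e0 e1] dinj djni diM djM niM njM eie eje.
have -> : dotv (di + ni + ei) (dj + nj + ej) - dotv di dj - dotv ni nj =
    dotv di ej + dotv ni ej + dotv ei dj + dotv ei nj + dotv ei ej.
  by rewrite !dotvDl !dotvDr dinj (dotvC ni dj) djni; ring.
have M0 : 0 <= M := le_trans (enorm_ge0 _) diM.
have cs (a b : 'rV[R]_m) (u v : R) : enorm a <= u -> enorm b <= v ->
    `|dotv a b| <= u * v.
  move=> au bv; apply: le_trans (cauchy_schwarz _ _) _.
  by rewrite ler_pM ?enorm_ge0.
have -> : (4 * M + 1) * e = M * e + M * e + e * M + e * M + e by ring.
do 4 (apply: le_trans (ler_normD _ _) _; apply: lerD; last by [exact: cs|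
  apply: le_trans (cs _ _ _ _ eie eje) _; rewrite ler_piMl]).
exact: cs.
Qed.

(** * Corrugations *)

Section Corrugation.
Context {R : realType} {n m : nat}.
Local Notation Z := (R * 'rV[R]_n)%type.
Variable r : R.

(** The infinitesimal bound provides normal fields. The bound on pairs gives injectivity with a
    Lipschitz inverse, and it survives uniform limits, which immersivity and injectivity alone do
    not. *)
Definition expanding (c : R) (y : Z -> 'rV[R]_m) : Prop :=
  [/\ C1K r y,
      forall z (v : 'rV[R]_n), cyl r z -> c * `|v| <= enorm (\sum_i v 0 i *: dx i y z) &
      forall t x x', cyl r (t, x) -> cyl r (t, x') ->
        c * `|x - x'| <= enorm (y (t, x) - y (t, x'))].

(** The infinitesimal bound with [c > 0] makes the Gram matrix of the derivatives invertible;
    codimension two leaves room for two normals. *)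
Lemma expanding_normal_fields c (y : Z -> 'rV[R]_m) : 0 < c ->
  (n + 2 <= m)%N -> expanding c y ->
  exists xi eta : Z -> 'rV[R]_m, [/\ contK r xi, contK r eta &
    forall z, cyl r z -> [/\ dotv (xi z) (xi z) = 1, dotv (eta z) (eta z) = 1,
      dotv (xi z) (eta z) = 0 &
      forall i, dotv (dx i y z) (xi z) = 0 /\ dotv (dx i y z) (eta z) = 0]].
Proof.
move=> c0 nm [[_ _ cdy] low _].
pose V z := \matrix_i dx i y z.
have cV : contK r V.
  apply/contK_mxP => i k; under eq_fun do rewrite mxE.
  exact: (contK_mxP _ _).1 (cdy i) 0 k.
have rowV i z : row i (V z) = dx i y z by apply/rowP => k; rewrite !mxE.
have uV z : cyl r z -> V z *m (V z)^T \in unitmx.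
  move=> zK; rewrite -row_free_unit; apply: inj_row_free => v vVV.
  have vV0 : v *m V z = 0.
    apply/eqP; rewrite -dotv_eq0 dotvE trmx_mul mulmxA -(mulmxA v) vVV mul0mx.
    by rewrite mxE.
  apply/eqP; rewrite -normr_le0 -(pmulr_rle0 _ c0).
  apply: le_trans (low z v zK) _.
  have -> : \sum_i v 0 i *: dx i y z = v *m V z.
    by rewrite mulmx_sum_row; apply: eq_bigr => i _; rewrite rowV.
  by rewrite vV0 enorm0.
have [xi [eta [cxi ceta H]]] := orthonormal_normal_frame _ _ _ cV uV nm.
exists xi, eta; split; [exact: cxi|exact: ceta|] => z zK.
have [h1 h2 h3 h4] := H z zK; split => // i.
by rewrite -rowV; exact: h4.
Qed.

Lemma ler_enorm_comb2 (a b : R) (u v : 'rV[R]_m) :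
  enorm (a *: u + b *: v) <= `|a| * enorm u + `|b| * enorm v.
Proof. by rewrite (le_trans (ler_enormD _ _))// !enormZ. Qed.

Definition phase (nu : 'rV[R]_n) (mu : R) (z : Z) : R :=
  \sum_i (nu 0 i / mu) * z.2 0 i.

Definition corrugation nu mu (alpha beta : Z -> 'rV[R]_m) z :=
  (mu * cos (phase nu mu z)) *: alpha z + (mu * sin (phase nu mu z)) *: beta z.

Definition corrugate (y : Z -> 'rV[R]_m) nu mu alpha beta z :=
  y z + corrugation nu mu alpha beta z.

(** The unit normal along which the derivative of the twist points at leading order: the factor [mu]
    of the twist cancels the [1 / mu] of its phase, leaving [nu_i * a] times this vector. *)
Definition corrugation_axis nu mu (xi eta : Z -> 'rV[R]_m) z :=
  - sin (phase nu mu z) *: xi z + cos (phase nu mu z) *: eta z.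

Section OneCorrugation.
(** [alpha] and [beta] are [C^1] substitutes for [a *: xi] and [a *: eta], with error [e1]. Their
    derivatives may be huge, but the bound [C] does not involve [mu], so [mu * C] can still be made
    small. *)
Variables (y alpha beta xi eta : Z -> 'rV[R]_m) (a : Z -> R) (nu : 'rV[R]_n).
Variables (mu C M e1 : R).
Hypothesis mu_gt0 : 0 < mu.
Hypothesis Cy : C1K r y.
Hypotheses (Calpha : C1K r alpha) (Cbeta : C1K r beta).
Hypothesis frame : forall z, cyl r z ->
  [/\ dotv (xi z) (xi z) = 1, dotv (eta z) (eta z) = 1,
      dotv (xi z) (eta z) = 0 &
      forall i, dotv (dx i y z) (xi z) = 0 /\ dotv (dx i y z) (eta z) = 0].
Hypothesis alpha_xi : forall z, cyl r z -> enorm (alpha z - a z *: xi z) <= e1.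
Hypothesis beta_eta : forall z, cyl r z -> enorm (beta z - a z *: eta z) <= e1.
Hypothesis alphaC : forall z, cyl r z -> enorm (alpha z) <= C.
Hypothesis betaC : forall z, cyl r z -> enorm (beta z) <= C.
Hypothesis dalphaC : forall i z, cyl r z -> enorm (dx i alpha z) <= C.
Hypothesis dbetaC : forall i z, cyl r z -> enorm (dx i beta z) <= C.
Hypothesis nuM : forall i, `|nu 0 i| <= M.

Local Notation theta := (phase nu mu).
Local Notation p := (corrugation nu mu alpha beta).
Local Notation y' := (corrugate y nu mu alpha beta).
Local Notation tau := (corrugation_axis nu mu xi eta).

Let Ctheta : C1K r theta.
Proof.
have h i := C1KM _ _ _ (C1K_cst r (nu 0 i / mu)) (C1K_coord r i).
exact: C1K_sum _ _ _ _ h.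
Qed.

Let dtheta i z : cyl r z -> dx i theta z = nu 0 i / mu.
Proof.
move=> zK; have h k := C1KM _ _ _ (C1K_cst r (nu 0 k / mu)) (C1K_coord r k).
rewrite (dx_sum _ _ _ _ _ _ h zK) (bigD1 i)//= big1 => [|k ki].
  rewrite (dxM _ _ _ _ _ (C1K_cst r _) (C1K_coord r _) zK) dx_cst dx_coord eqxx.
  by rewrite mulr1 mulr0 !addr0.
rewrite (dxM _ _ _ _ _ (C1K_cst r _) (C1K_coord r _) zK) dx_cst dx_coord.
by rewrite eq_sym (negbTE ki) !mulr0 addr0.
Qed.

Let Ccos : C1K r (fun z => mu * cos (theta z)).
Proof.
apply: C1KM _ _ _ (C1K_cst r mu) _.
apply: (C1K_comp _ (@cos R) (fun x => - sin x) _ _ _ Ctheta) => z zK.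
by apply: cvgN; exact: continuous_sin.
Qed.

Let Csin : C1K r (fun z => mu * sin (theta z)).
Proof.
apply: C1KM _ _ _ (C1K_cst r mu) _.
apply: (C1K_comp _ (@sin R) (@cos R) _ _ _ Ctheta) => z zK.
exact: continuous_cos.
Qed.

Let dcos i z : cyl r z ->
  dx i (fun z => mu * cos (theta z)) z = - nu 0 i * sin (theta z).
Proof.
move=> zK; have Cc : C1K r (fun z => cos (theta z)).
  apply: (C1K_comp _ (@cos R) (fun x => - sin x) _ _ _ Ctheta) => x xK.
  by apply: cvgN; exact: continuous_sin.
rewrite (dxM _ _ _ _ _ (C1K_cst r mu) Cc zK) dx_cst mulr0 addr0.
rewrite (dx_comp _ _ _ _ _ _ Ctheta zK (is_derive_cos _)) dtheta//.
by field; rewrite gt_eqF.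
Qed.

Let dsin i z : cyl r z ->
  dx i (fun z => mu * sin (theta z)) z = nu 0 i * cos (theta z).
Proof.
move=> zK; have Cc : C1K r (fun z => sin (theta z)).
  apply: (C1K_comp _ (@sin R) (@cos R) _ _ _ Ctheta) => x xK.
  exact: continuous_cos.
rewrite (dxM _ _ _ _ _ (C1K_cst r mu) Cc zK) dx_cst mulr0 addr0.
rewrite (dx_comp _ _ _ _ _ _ Ctheta zK (is_derive_sin _)) dtheta//.
by field; rewrite gt_eqF.
Qed.

Let Cp : C1K r p.
Proof.
exact: C1KD _ _ _ (C1KZ _ _ _ Ccos Calpha) (C1KZ _ _ _ Csin Cbeta).
Qed.

Lemma C1K_corrugation : C1K r y'.
Proof. exact: C1KD _ _ _ Cy Cp. Qed.

Let mucos z : `|mu * cos (theta z)| <= mu.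
Proof. by rewrite normrM gtr0_norm// ler_piMr ?cos_max ?ltW. Qed.

Let musin z : `|mu * sin (theta z)| <= mu.
Proof. by rewrite normrM gtr0_norm// ler_piMr ?sin_max ?ltW. Qed.

Lemma corrugation_small z : cyl r z -> enorm (p z) <= 2 * mu * C.
Proof.
move=> zK; apply: le_trans (ler_enorm_comb2 _ _ _ _) _.
have -> : 2 * mu * C = mu * C + mu * C by ring.
by apply: lerD; [apply: ler_pM; [exact: normr_ge0|exact: enorm_ge0|
    exact: mucos|exact: alphaC]|
    apply: ler_pM; [exact: normr_ge0|exact: enorm_ge0|exact: musin|exact: betaC]].
Qed.

(** In the product rule, the terms that differentiate [alpha] and [beta] keep a factor [mu] and cost
    [2 * mu * C]. In those that differentiate the phase, replacing [alpha] and [beta] by [a *: xi]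
    and [a *: eta] costs [2 * M * e1]. *)
Lemma corrugation_derivative i z : cyl r z ->
  enorm (dx i y' z - dx i y z - (nu 0 i * a z) *: tau z)
    <= 2 * mu * C + 2 * M * e1.
Proof.
move=> zK; rewrite (dxD _ _ _ _ _ Cy Cp zK) (addrC (dx i y z)) addrK.
rewrite (dxD _ _ _ _ _ (C1KZ _ _ _ Ccos Calpha) (C1KZ _ _ _ Csin Cbeta) zK).
rewrite (dxZ _ _ _ _ _ Ccos Calpha zK) (dxZ _ _ _ _ _ Csin Cbeta zK).
rewrite dcos// dsin//.
set u := _ - _.
have -> : u = ((mu * cos (theta z)) *: dx i alpha z
             + (mu * sin (theta z)) *: dx i beta z)
    + ((- nu 0 i * sin (theta z)) *: (alpha z - a z *: xi z)
       + (nu 0 i * cos (theta z)) *: (beta z - a z *: eta z)).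
  by apply/rowP => k; rewrite /u /corrugation_axis !mxE; ring.
apply: le_trans (ler_enormD _ _) _; apply: lerD.
  apply: le_trans (ler_enorm_comb2 _ _ _ _) _.
  have -> : 2 * mu * C = mu * C + mu * C by ring.
  by apply: lerD; [apply: ler_pM; [exact: normr_ge0|exact: enorm_ge0|
    exact: mucos|exact: dalphaC]|
    apply: ler_pM; [exact: normr_ge0|exact: enorm_ge0|exact: musin|exact: dbetaC]].
apply: le_trans (ler_enorm_comb2 _ _ _ _) _.
have -> : 2 * M * e1 = M * e1 + M * e1 by ring.
have nus (s : R) : `|s| <= 1 -> `|nu 0 i * s| <= M.
  by move=> s1; rewrite normrM (le_trans _ (nuM i))// ler_piMr.
apply: lerD; apply: ler_pM; rewrite ?normr_ge0 ?enorm_ge0//.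
- by rewrite mulNr normrN nus// sin_max.
- exact: alpha_xi.
- by rewrite nus// cos_max.
- exact: beta_eta.
Qed.

Lemma tau_unit z : cyl r z -> dotv (tau z) (tau z) = 1.
Proof.
move=> zK; have [h1 h2 h3 _] := frame z zK.
rewrite /corrugation_axis dotvDl !dotvDr !dotvZl !dotvZr h1 h2 (dotvC (eta z)) h3.
rewrite !mulr0 addr0 add0r !mulr1 mulrNN -!expr2 addrC.
exact: cos2Dsin2.
Qed.

Lemma tau_normal i z : cyl r z -> dotv (dx i y z) (tau z) = 0.
Proof.
move=> zK; have [_ _ _ /(_ i)[h1 h2]] := frame z zK.
by rewrite /corrugation_axis dotvDr !dotvZr h1 h2 !mulr0 addr0.
Qed.

(** The new differential is the old one, plus a multiple of the normal [tau], plus errors; by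
    orthogonality the normal part does not shorten the first. *)
Lemma corrugation_immersion e2 z (v : 'rV[R]_n) : cyl r z ->
  2 * mu * C + 2 * M * e1 <= e2 ->
  enorm (\sum_i v 0 i *: dx i y z) - n%:R * e2 * `|v|
    <= enorm (\sum_i v 0 i *: dx i y' z).
Proof.
move=> zK he2; pose err i := dx i y' z - dx i y z - (nu 0 i * a z) *: tau z.
have -> : \sum_i v 0 i *: dx i y' z = (\sum_i v 0 i *: dx i y z
    + (\sum_i v 0 i * (nu 0 i * a z)) *: tau z) + \sum_i v 0 i *: err i.
  rewrite scaler_suml -!big_split /=; apply: eq_bigr => i _.
  by apply/rowP => k; rewrite !mxE; ring.
set T := \sum_i v 0 i *: dx i y z; set N := _ *: tau z; set o := \sum_i _ *: err i.
have TN : enorm T <= enorm (T + N).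
  apply: enorm_sub_orthogonal; rewrite dotvZr dotv_suml.
  rewrite [X in _ * X]big1 ?mulr0// => i _.
  by rewrite dotvZl tau_normal// mulr0.
have oe : enorm o <= n%:R * e2 * `|v|.
  apply: le_trans (ler_enorm_sum _ _) _.
  apply: (@le_trans _ _ (\sum_(i < n) `|v| * e2)).
    apply: ler_sum => i _; rewrite enormZ ler_pM ?enorm_ge0 ?ler_entry_norm//.
    exact: le_trans (corrugation_derivative i _ zK) he2.
  by rewrite sumr_const card_ord -[leLHS]mulr_natl mulrCA mulrC.
have := ler_enorm_sub (T + N) (- o); rewrite opprK enormN; lra.
Qed.

(** Far pairs are controlled by the smallness of the twist. For near pairs, both differences are
    compared with their tangent and normal parts at the one base point [x']. The phase may turn many
    times between [x] and [x'], yet [mu] times its variation is at most [n * M * |x - x'|], so the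
    normal amplitude errors stay proportional to the distance. *)
Lemma corrugation_expanding rho e2 L t x x' :
  0 < e2 -> cyl r (t, x) -> cyl r (t, x') ->
  (`|x - x'| < rho ->
     enorm (y (t, x) - y (t, x') - \sum_i (x - x') 0 i *: dx i y (t, x'))
       <= e2 * `|x - x'|) ->
  enorm (alpha (t, x) - alpha (t, x')) <= L * `|x - x'| ->
  enorm (beta (t, x) - beta (t, x')) <= L * `|x - x'| ->
  4 * mu * C <= rho * e2 ->
  enorm (y (t, x) - y (t, x'))
    - (2 * e2 + 2 * mu * L + 2 * (n%:R * M) * e1) * `|x - x'|
    <= enorm (y' (t, x) - y' (t, x')).
Proof.
move=> e20 xK x'K ydiff aL bL muC.
have e10 : 0 <= e1 := le_trans (enorm_ge0 _) (alpha_xi _ xK).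
have C0 : 0 <= C := le_trans (enorm_ge0 _) (alphaC _ xK).
have L0 : 0 <= L * `|x - x'| := le_trans (enorm_ge0 _) aL.
have nM0 : 0 <= n%:R * M.
  case: n nu nuM => [|n'] nu' nuM'; first by rewrite mul0r.
  by rewrite mulr_ge0// (le_trans _ (nuM' ord0)).
set D := `|x - x'| in ydiff aL bL L0 *.
have D0 : 0 <= D by exact: normr_ge0.
have -> : (2 * e2 + 2 * mu * L + 2 * (n%:R * M) * e1) * D =
  2 * (e2 * D) + 2 * mu * (L * D) + 2 * ((n%:R * M) * D * e1) by ring.
have muL : 0 <= mu * (L * D) by rewrite mulr_ge0// ltW.
have nMD : 0 <= (n%:R * M) * D * e1 := mulr_ge0 (mulr_ge0 nM0 D0) e10.
have y'E : y' (t, x) - y' (t, x') = (y (t, x) - y (t, x')) + (p (t, x) - p (t, x')).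
  by rewrite /corrugate; apply/rowP => k; rewrite !mxE; ring.
(* Far pairs come first: the twist moves the two points by at most
   [4 * mu * C <= rho * e2 <= e2 * D] together. *)
rewrite y'E; have [Drho|rhoD] := ltP D rho; last first.
  have pp : enorm (p (t, x) - p (t, x')) <= e2 * D.
    apply: le_trans (ler_enormB _ _) _.
    apply: (@le_trans _ _ (4 * mu * C)).
      have := corrugation_small _ xK; have := corrugation_small _ x'K; lra.
    by rewrite (le_trans muC)// mulrC ler_wpM2l// ltW.
  have := ler_enorm_sub (y (t, x) - y (t, x')) (- (p (t, x) - p (t, x'))).
  have : 0 <= e2 * D by rewrite mulr_ge0// ltW.
  by rewrite opprK enormN; lra.
have {}ydiff := ydiff Drho.
set z := (t, x) in xK aL bL ydiff *; set z' := (t, x') in x'K aL bL ydiff *.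
pose T := \sum_i (x - x') 0 i *: dx i y z'.
pose c1 := mu * cos (theta z) - mu * cos (theta z').
pose c2 := mu * sin (theta z) - mu * sin (theta z').
have thetaE : mu * `|theta z - theta z'| <= n%:R * M * D.
  rewrite -[X in X * _](gtr0_norm mu_gt0) -normrM /phase -sumrB mulr_sumr.
  rewrite (le_trans (ler_norm_sum _ _ _))//.
  apply: (@le_trans _ _ (\sum_(i < n) M * D)).
    apply: ler_sum => i _; rewrite -mulrBr mulrA mulrCA divff ?gt_eqF// mulr1.
    rewrite normrM ler_pM//.
    by have := ler_entry_norm (x - x') 0 i; rewrite !mxE.
  by rewrite sumr_const card_ord -[leLHS]mulr_natl mulrA.
have c1P : `|c1| <= n%:R * M * D.
  rewrite /c1 -mulrBr normrM gtr0_norm//; apply: le_trans thetaE.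
  by rewrite ler_wpM2l ?(ltW mu_gt0)// ler_dist_cos.
have c2P : `|c2| <= n%:R * M * D.
  rewrite /c2 -mulrBr normrM gtr0_norm//; apply: le_trans thetaE.
  by rewrite ler_wpM2l ?(ltW mu_gt0)// ler_dist_sin.
(* The difference of the twists is [N + o2 + o3]: [N] is exactly normal at [z'], [o2] is the
   variation of [alpha] and [beta] between the points, [o3] their distance at [z'] from [a *: xi]
   and [a *: eta]. The nonlinear part of [y] is [o1]. *)
pose N := (a z' * c1) *: xi z' + (a z' * c2) *: eta z'.
pose o1 := y z - y z' - T.
pose o2 := (mu * cos (theta z)) *: (alpha z - alpha z')
  + (mu * sin (theta z)) *: (beta z - beta z').
pose o3 := c1 *: (alpha z' - a z' *: xi z') + c2 *: (beta z' - a z' *: eta z').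
have yE : y z - y z' = T + o1 by rewrite /o1 [RHS]addrC subrK.
have totE : y z - y z' + (p z - p z') = (T + N) + (o1 + o2 + o3).
  rewrite yE; apply/rowP => k.
  rewrite /corrugation /N /o2 /o3 /c1 /c2; move: T o1 {yE} => T' o1'.
  by rewrite !mxE; ring.
have TN : enorm T <= enorm (T + N).
  apply: enorm_sub_orthogonal; rewrite dotv_suml big1// => i _.
  have [_ _ _ /(_ i)[h1 h2]] := frame _ x'K.
  by rewrite dotvZl dotvDr !dotvZr h1 h2 !mulr0 addr0 mulr0.
have o2P : enorm o2 <= 2 * mu * (L * D).
  apply: le_trans (ler_enorm_comb2 _ _ _ _) _.
  have -> : 2 * mu * (L * D) = mu * (L * D) + mu * (L * D) by ring.
  by apply: lerD; [apply: ler_pM; [exact: normr_ge0|exact: enorm_ge0|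
    exact: mucos|exact: aL]|
    apply: ler_pM; [exact: normr_ge0|exact: enorm_ge0|exact: musin|exact: bL]].
have o3P : enorm o3 <= 2 * (n%:R * M * D * e1).
  apply: le_trans (ler_enorm_comb2 _ _ _ _) _.
  rewrite mulrDl mul1r.
  by apply: lerD; [apply: ler_pM; [exact: normr_ge0|exact: enorm_ge0|
    exact: c1P|exact: (alpha_xi _ x'K)]|
    apply: ler_pM; [exact: normr_ge0|exact: enorm_ge0|
    exact: c2P|exact: (beta_eta _ x'K)]].
have h1 := ler_enorm_sub (T + N) (- (o1 + o2 + o3)).
rewrite opprK enormN -totE in h1.
have h2 := ler_enormD T o1; rewrite -yE in h2.
have h3 := ler_enormD (o1 + o2) o3; have h4 := ler_enormD o1 o2.
have h5 : enorm o1 <= e2 * D by exact: ydiff.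
lra.
Qed.

End OneCorrugation.

End Corrugation.

(** * One twist, with its parameters chosen *)

Section CorrugationStep.
Context {R : realType} {n m : nat}.
Local Notation Z := (R * 'rV[R]_n)%type.
Variable r : R.

(** The order of choices matters: [e3] from bounds on [a], [nu] and the derivatives of [y]; then
    [e1] and the [C^1] approximations; then [C], which bounds these; and [mu] last. *)
Lemma corrugation_step c (y : Z -> 'rV[R]_m) (a : Z -> R)
    (nu : 'rV[R]_n) (e : R) : 0 < c ->
  (n + 2 <= m)%N -> expanding r c y -> contK r a -> 0 < e ->
  exists y', [/\ expanding r (c - e) y',
    forall z, cyl r z -> enorm (y' z - y z) <= e,
    forall i z, cyl r z ->
      enorm (dx i y' z - dx i y z) <= `|a z| * `|nu 0 i| + e &
    forall i j z, cyl r z ->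
      `|dotv (dx i y' z) (dx j y' z) - dotv (dx i y z) (dx j y z)
        - a z ^+ 2 * (nu 0 i * nu 0 j)| <= e].
Proof.
move=> c0 nm ey ca e0; have [Cy low1 low2] := ey; have [_ _ cdy] := Cy.
have [xi [eta [cxi ceta frame]]] := expanding_normal_fields _ _ _ c0 nm ey.
have [M1 M10 dyM1] := contK_enorm_bounded _ _ _ cdy.
have [A A0 aA] := contK_bounded _ _ ca.
pose M := `|nu| + 1; have M0 : 0 < M by rewrite ltr_wpDl.
have nuM i : `|nu 0 i| <= M by rewrite (le_trans (ler_entry_norm _ _ _))// lerDl.
pose Mt := M1 + M * A; have Mt0 : 0 < Mt by rewrite addr_gt0// mulr_gt0.
have M1Mt : M1 <= Mt by rewrite lerDl mulr_ge0// ltW.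
have MAMt : M * A <= Mt by rewrite lerDr ltW.
clearbody Mt M.
(* [4 * Mt + 1] is the factor of [metric_perturbation] and [n] that of [corrugation_immersion]; [K]
   dominates both, and [1]. *)
pose K : R := 4 * Mt + n%:R + 3; have K0 : 0 < K.
  by rewrite ltr_wpDl// addr_ge0// mulr_ge0// ltW.
pose e3 := Num.min 1 (e / K).
have e30 : 0 < e3 by rewrite lt_min ltr01 divr_gt0.
have e31 : e3 <= 1 by rewrite ge_min lexx.
have e3K : K * e3 <= e.
  by rewrite mulrC -ler_pdivlMr// ge_min lexx orbT.
clearbody e3.
have e1D : 0 < 4 * n.+1%:R * M by rewrite !mulr_gt0.
(* With this value [M * e1] and [n%:R * M * e1] are both at most [e3 / 4]. *)
pose e1 : R := e3 / (4 * n.+1%:R * M); have e10 : 0 < e1 by rewrite divr_gt0.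
have e1E : n.+1%:R * M * e1 = e3 / 4.
  by rewrite /e1; field; rewrite (gt_eqF M0) nat1r pnatr_eq0.
have appr (f : Z -> 'rV[R]_m) : contK r f -> exists2 g : Z -> 'rV[R]_m, C1K r g &
    forall z, cyl r z -> enorm (g z - a z *: f z) <= e1.
  move=> cf; have m10 : 0 < e1 / m.+1%:R by rewrite divr_gt0.
  have [g Cg fg] := approx_C1K _ _ _ (contKZ _ _ _ ca cf) m10.
  exists g => // z zK; rewrite -enormN opprB (le_trans (enorm_le_norm _))//.
  apply: (@le_trans _ _ (m%:R * (e1 / m.+1%:R))); first by rewrite ler_wpM2l// fg.
  by rewrite mulrCA ler_piMr ?(ltW e10)// ler_pdivrMr// mul1r ler_nat.
have [alpha Calpha alpha_xi] := appr _ cxi.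
have [beta Cbeta beta_eta] := appr _ ceta.
have [_ cal cdal] := Calpha; have [_ cbe cdbe] := Cbeta.
have bdd (f : Z -> 'rV[R]_m) : C1K r f -> exists2 C, 0 < C &
    [/\ forall z, cyl r z -> enorm (f z) <= C,
        forall i z, cyl r z -> enorm (dx i f z) <= C &
        forall t x x', cyl r (t, x) -> cyl r (t, x') ->
          enorm (f (t, x) - f (t, x')) <= C * `|x - x'|].
  move=> Cf; have [_ cf cdf] := Cf.
  have [B1 B10 B1P] := contK_enorm_bounded _ _ (fun _ : 'I_1 => f) (fun=> cf).
  have [B2 B20 B2P] := contK_enorm_bounded _ _ _ cdf.
  have [B3 B30 B3P] := C1K_lipschitz _ _ Cf.
  exists (B1 + B2 + B3); first by rewrite !addr_gt0.
  split=> [z zK|i z zK|t x x' xK x'K].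
  - by have := B1P ord0 z zK; lra.
  - by have := B2P i z zK; lra.
  - by rewrite (le_trans (B3P _ _ _ xK x'K))// ler_wpM2r// lerDr addr_ge0// ltW.
have [Ca Ca0 [alC dalC Lal]] := bdd _ Calpha.
have [Cb Cb0 [beC dbeC Lbe]] := bdd _ Cbeta.
pose C := Ca + Cb; have C0 : 0 < C by rewrite addr_gt0.
have CaC : Ca <= C by rewrite lerDl ltW.
have CbC : Cb <= C by rewrite lerDr ltW.
have e80 : 0 < e / 8 by rewrite divr_gt0.
have [rho rho0 ydiff] := C1K_uniform_diff _ _ _ Cy e80.
(* The first bound makes the twist and the error of its derivative small; the second handles the
   pairs farther apart than [rho]. *)
pose mu := Num.min (e3 / (8 * C)) (rho * (e / 8) / (4 * C)).
have mu0 : 0 < mu by rewrite lt_min !divr_gt0 ?mulr_gt0.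
have muC1 : 8 * (mu * C) <= e3.
  by rewrite mulrA (mulrC 8) -mulrA -ler_pdivlMr ?mulr_gt0// ge_min lexx.
have muC2 : 4 * mu * C <= rho * (e / 8).
  by rewrite (mulrC 4) -mulrA -ler_pdivlMr ?mulr_gt0// ge_min lexx orbT.
clearbody mu C e1.
have alC' z : cyl r z -> enorm (alpha z) <= C.
  by move=> zK; apply: le_trans CaC; exact: alC.
have beC' z : cyl r z -> enorm (beta z) <= C.
  by move=> zK; apply: le_trans CbC; exact: beC.
have dalC' i z : cyl r z -> enorm (dx i alpha z) <= C.
  by move=> zK; apply: le_trans CaC; exact: dalC.
have dbeC' i z : cyl r z -> enorm (dx i beta z) <= C.
  by move=> zK; apply: le_trans CbC; exact: dbeC.
have K3 : (4 * Mt + 1) * e3 <= e /\ n%:R * e3 <= e /\ e3 <= e.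
  move: e3K; have : 0 <= Mt * e3 by rewrite mulr_ge0// ltW.
  have : 0 <= n%:R * e3 by rewrite mulr_ge0// ltW.
  rewrite /K !mulrDl -mulrA => h1 h2 h3.
  by move: (Mt * e3) (n%:R * e3) h1 h2 h3 => u v *; split; [|split]; lra.
have [K31 [K32 K33]] := K3.
have nMe : n%:R * M * e1 <= e3 / 4.
  by rewrite -e1E ler_wpM2r ?(ltW e10)// ler_wpM2r ?(ltW M0)// ler_nat.
have Me : M * e1 <= e3 / 4.
  rewrite -e1E ler_wpM2r ?(ltW e10)// ler_peMl ?(ltW M0)//.
  by rewrite ler1n.
have he3 : 2 * mu * C + 2 * M * e1 <= e3 by lra.
exists (corrugate y nu mu alpha beta); split.
- split; first exact: C1K_corrugation.
    move=> z v zK.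
    have := corrugation_immersion _ _ _ _ _ _ _ _ _ _ _ _ mu0 Cy Calpha Cbeta
      frame alpha_xi beta_eta dalC' dbeC' nuM _ _ v zK he3.
    have := low1 z v zK.
    have h1 : n%:R * e3 * `|v| <= e * `|v| by rewrite ler_wpM2r.
    by move=> h2; apply: le_trans; rewrite mulrBl; exact: lerB h2 h1.
  move=> t x x' xK x'K.
  have aL : enorm (alpha (t, x) - alpha (t, x')) <= C * `|x - x'|.
    by rewrite (le_trans (Lal _ _ _ xK x'K))// ler_wpM2r.
  have bL : enorm (beta (t, x) - beta (t, x')) <= C * `|x - x'|.
    by rewrite (le_trans (Lbe _ _ _ xK x'K))// ler_wpM2r.
  have := corrugation_expanding _ _ _ _ _ _ _ _ _ _ _ _ mu0 frame alpha_xi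
    beta_eta alC' beC' nuM _ _ _ _ _ _ e80 xK x'K (ydiff _ _ _ xK x'K) aL bL muC2.
  have := low2 _ _ _ xK x'K.
  have h1 : (2 * (e / 8) + 2 * mu * C + 2 * (n%:R * M) * e1) * `|x - x'| <= e * `|x - x'|.
    by rewrite ler_wpM2r//; lra.
  by move=> h2; apply: le_trans; rewrite mulrBl; exact: lerB h2 h1.
- move=> z zK; rewrite /corrugate addrC addKr.
  by apply: le_trans (corrugation_small _ _ _ _ _ _ mu0 alC' beC' _ zK) _; lra.
- move=> i z zK.
  have := corrugation_derivative _ _ _ _ _ _ _ _ _ _ _ _ mu0 Cy Calpha Cbeta
    alpha_xi beta_eta dalC' dbeC' nuM i _ zK.
  set u := _ - dx i y z; set v := _ *: _ => uv.
  have vE : enorm v = `|a z| * `|nu 0 i|.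
    rewrite /v enormZ /enorm (tau_unit _ _ _ _ _ _ frame _ zK) sqrtr1 mulr1.
    by rewrite normrM mulrC.
  by have := ler_enorm_sub u v; rewrite vE; lra.
- move=> i j z zK.
  pose tau := corrugation_axis nu mu xi eta z.
  pose ni k := (nu 0 k * a z) *: tau.
  pose err k := dx k (corrugate y nu mu alpha beta) z - dx k y z - ni k.
  have errP k : enorm (err k) <= e3.
    apply: le_trans he3.
    exact: (corrugation_derivative _ _ _ _ _ _ _ _ _ _ _ _ mu0 Cy Calpha Cbeta
      alpha_xi beta_eta dalC' dbeC' nuM _ _ zK).
  have dE k : dx k (corrugate y nu mu alpha beta) z = dx k y z + ni k + err k.
    by apply/rowP => l; rewrite /err; move: (ni k) => u; rewrite !mxE; ring.
  have tt : dotv tau tau = 1 by exact: (tau_unit _ _ _ _ _ _ frame _ zK).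
  have dn k l : dotv (dx k y z) (ni l) = 0.
    by rewrite dotvZr (tau_normal _ _ _ _ _ _ frame _ _ zK) mulr0.
  have nE : dotv (ni i) (ni j) = a z ^+ 2 * (nu 0 i * nu 0 j).
    by rewrite dotvZl dotvZr tt; ring.
  have nMt k : enorm (ni k) <= Mt.
    rewrite enormZ /enorm tt sqrtr1 mulr1 normrM; apply: le_trans MAMt.
    by apply: ler_pM; rewrite ?normr_ge0// aA.
  have dMt k : enorm (dx k y z) <= Mt.
    by rewrite (le_trans (dyM1 _ _ zK)).
  rewrite !dE -nE; apply: le_trans K31.
  by apply: metric_perturbation; rewrite ?(ltW e30).
Qed.

End CorrugationStep.

Section ManyCorrugations.
Context {R : realType} {n m : nat}.
Local Notation Z := (R * 'rV[R]_n)%type.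
Variable r : R.

Lemma expanding_le c c' (y : Z -> 'rV[R]_m) :
  c' <= c -> expanding r c y -> expanding r c' y.
Proof.
move=> cc [Cy h1 h2]; split; first exact: Cy.
  by move=> z v zK; apply: le_trans (h1 z v zK); rewrite ler_wpM2r.
by move=> t x x' xK x'K; apply: le_trans (h2 _ _ _ xK x'K); rewrite ler_wpM2r.
Qed.

Lemma corrugation_steps (I : Type) (s : seq I) (a : I -> Z -> R)
    (nu : I -> 'rV[R]_n) c (y : Z -> 'rV[R]_m) (e : R) : 0 < e -> e < c ->
  (n + 2 <= m)%N -> expanding r c y -> (forall k, contK r (a k)) ->
  exists y', [/\ expanding r (c - e) y',
    forall z, cyl r z -> enorm (y' z - y z) <= e,
    forall i z, cyl r z ->
      enorm (dx i y' z - dx i y z) <= \sum_(k <- s) `|a k z| * `|nu k 0 i| + e &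
    forall i j z, cyl r z ->
      `|dotv (dx i y' z) (dx j y' z) - dotv (dx i y z) (dx j y z)
        - \sum_(k <- s) a k z ^+ 2 * (nu k 0 i * nu k 0 j)| <= e].
Proof.
move=> + + nm + ca; elim: s c y e => [|k s ih] c y e e0 ec ey.
  exists y; split.
  - by apply: expanding_le ey; rewrite lerBlDr lerDl ltW.
  - by move=> z _; rewrite subrr enorm0 ltW.
  - by move=> i z _; rewrite subrr enorm0 big_nil add0r ltW.
  - by move=> i j z _; rewrite subrr big_nil subrr normr0 ltW.
have e20 : 0 < e / 2 by rewrite divr_gt0.
have ec1 : e / 2 < c by lra.
have c20 : 0 < c - e / 2 by lra.
have [y1 [ey1 yy1 dy1 hy1]] := ih c y _ e20 ec1 ey.
have [y2 [ey2 yy2 dy2 hy2]] := corrugation_step _ _ _ _ (nu k) _ c20 nm ey1 (ca k) e20.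
exists y2; split.
- by move: ey2; rewrite -addrA -opprD -splitr.
- move=> z zK; rewrite -(subrKA (y1 z)) (splitr e).
  by rewrite (le_trans (ler_enormD _ _))// lerD ?yy1 ?yy2.
- move=> i z zK; rewrite -(subrKA (dx i y1 z)) big_cons (splitr e).
  rewrite (le_trans (ler_enormD _ _))//.
  have h1 := dy1 i z zK; have h2 := dy2 i z zK.
  apply: le_trans (lerD h2 h1) _; rewrite le_eqVlt; apply/orP; left.
  by apply/eqP; ring.
- move=> i j z zK; rewrite big_cons (splitr e).
  set A2 := dotv (dx i y2 z) _; set A0 := dotv (dx i y z) _.
  set T := a k z ^+ 2 * _; set S := \sum_(_ <- _) _.
  pose A1 := dotv (dx i y1 z) (dx j y1 z).
  have -> : A2 - A0 - (T + S) = (A2 - A1 - T) + (A1 - A0 - S) by ring.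
  rewrite (le_trans (ler_normD _ _))//.
  exact: lerD (hy2 i j z zK) (hy1 i j z zK).
Qed.

End ManyCorrugations.

(** * Filling a deficit close to a multiple of the identity *)

Section Stage.
Context {R : realType} {m : nat}.
Local Notation Z := (R * 'rV[R]_3)%type.
Local Notation i2 := (2%:R : 'I_3).

Lemma ord3_cases (P : 'I_3 -> Prop) : P 0 -> P 1 -> P i2 -> forall i, P i.
Proof.
move=> p0 p1 p2 [[|[|[|//]]] h].
- by rewrite (_ : Ordinal h = 0)//; exact: val_inj.
- by rewrite (_ : Ordinal h = 1)//; exact: val_inj.
- by rewrite (_ : Ordinal h = i2)//; exact: val_inj.
Qed.

(* The vectors e_i + e_j and e_i - e_j for i < j, and the coefficients of a
   symmetric matrix on their squares; the latter are positive near the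
   identity. *)
Definition prim_dir (k : nat) : 'rV[R]_3 :=
  \row_l nth 0 (nth [::] [:: [:: 1; 1; 0]; [:: 1; -1; 0]; [:: 1; 0; 1];
                            [:: 1; 0; -1]; [:: 0; 1; 1]; [:: 0; 1; -1]] k) l.

Definition prim_coef (D : 'M[R]_3) (k : nat) : R :=
  nth 0 [:: ((D 0 0 + D 1 1 - D i2 i2) / 2 + D 0 1) / 2;
            ((D 0 0 + D 1 1 - D i2 i2) / 2 - D 0 1) / 2;
            ((D 0 0 + D i2 i2 - D 1 1) / 2 + D 0 i2) / 2;
            ((D 0 0 + D i2 i2 - D 1 1) / 2 - D 0 i2) / 2;
            ((D 1 1 + D i2 i2 - D 0 0) / 2 + D 1 i2) / 2;
            ((D 1 1 + D i2 i2 - D 0 0) / 2 - D 1 i2) / 2] k.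

Lemma prim_decomposition (D : 'M[R]_3) : (forall i j, D i j = D j i) ->
  forall i j, \sum_(k <- iota 0 6)
    prim_coef D k * (prim_dir k 0 i * prim_dir k 0 j) = D i j.
Proof.
move=> sD; rewrite /= => i j; rewrite !big_cons big_nil /prim_coef /=.
move: i j; apply: ord3_cases; apply: ord3_cases; rewrite !mxE /=;
  by rewrite ?(sD 1 0) ?(sD i2 0) ?(sD i2 1); field.
Qed.

(** At [d] times the identity the six coefficients equal [d / 4], and entrywise errors of [d / 20]
    move them by at most [d / 16]. From index 6 on, the default value is [0]. *)
Lemma prim_coef_bounds (D : 'M[R]_3) (d : R) k : 0 <= d ->
  (forall i j, `|D i j - d * (i == j)%:R| <= d / 20) ->
  0 <= prim_coef D k <= d.
Proof.
move=> d0 h; have hD i j := h i j; move: (hD 0 0) (hD 1 1) (hD i2 i2) (hD 0 1).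
move: (hD 0 i2) (hD 1 i2); rewrite /= !mulr1 !mulr0 !subr0.
move=> /ler_normlP[a1 a2] /ler_normlP[b1 b2] /ler_normlP[c1 c2].
move=> /ler_normlP[d1 d2] /ler_normlP[e1 e2] /ler_normlP[f1 f2].
rewrite /prim_coef.
by do 6! [case: k => [|k]; first by apply/andP; split; rewrite /=; lra];
  rewrite /= nth_nil lexx.
Qed.

Lemma prim_dir_le1 k i : `|prim_dir k 0 i| <= 1.
Proof.
rewrite mxE; move: i; apply: ord3_cases;
  by do 6! [case: k => [|k]; first by rewrite /= ?normrN ?normr1 ?normr0];
  rewrite /= nth_nil nth_nil normr0.
Qed.

Variable r : R.

Lemma contK_prim_coef (D : Z -> 'M[R]_3) k :
  contK r D -> contK r (fun z => prim_coef (D z) k).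
Proof.
move=> /contK_mxP cD.
have half (f : Z -> R) : contK r f -> contK r (fun z => f z / 2).
  by move=> cf; exact: contKM _ _ _ cf (contK_cst _ _).
have s i j l := half _ (contKB _ _ _ (contKD _ _ _ (cD i i) (cD j j)) (cD l l)).
have p i j l a b := half _ (contKD _ _ _ (s i j l) (cD a b)).
have q i j l a b := half _ (contKB _ _ _ (s i j l) (cD a b)).
case: k => [|[|[|[|[|[|k]]]]]]; first exact: p.
- exact: q.
- exact: p.
- exact: q.
- exact: p.
- exact: q.
- by rewrite /prim_coef /= nth_nil; exact: contK_cst.
Qed.

(** The matrix [D] to be added is [3 / 4 * d] times the identity up to [d / 40], which is below the
    tolerance [(3 / 4 * d) / 20] of [prim_coef_bounds]. Hence its coefficients are nonnegative, and
    their square roots are amplitudes of size at most [Num.sqrt d]. *)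
Lemma corrugation_stage (G : Z -> 'M[R]_3) (c d e : R) (y : Z -> 'rV[R]_m) :
  (5 <= m)%N -> contK r G -> (forall z i j, cyl r z -> G z i j = G z j i) ->
  0 < d -> 0 < e -> e < c -> expanding r c y ->
  (forall i j z, cyl r z ->
    `|dotv (dx i y z) (dx j y z) - (G z i j - d * (i == j)%:R)| <= d / 40) ->
  exists y', [/\ expanding r (c - e) y',
    forall z, cyl r z -> enorm (y' z - y z) <= e,
    forall i z, cyl r z ->
      enorm (dx i y' z - dx i y z) <= 6 * Num.sqrt d + e &
    forall i j z, cyl r z ->
      `|dotv (dx i y' z) (dx j y' z) - (G z i j - d / 4 * (i == j)%:R)| <= e].
Proof.
move=> m5 cG sG d0 e0 ec ey hy; have [[_ _ cdy] _ _] := ey.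
pose D z : 'M[R]_3 := \matrix_(i, j)
  (G z i j - d / 4 * (i == j)%:R - dotv (dx i y z) (dx j y z)).
have cD : contK r D.
  apply/contK_mxP => i j; under eq_fun do rewrite mxE.
  have cGij := (contK_mxP _ _).1 cG i j.
  exact: contKB _ _ _ (contKB _ _ _ cGij (contK_cst _ _))
    (contK_dotv _ _ _ (cdy i) (cdy j)).
have sD z i j : cyl r z -> D z i j = D z j i.
  move=> zK; have e1 := eq_sym i j; have e2 := dotvC (dx i y z) (dx j y z).
  have e3 := sG z i j zK.
  rewrite [LHS]mxE [RHS]mxE e3 e1 e2.
  reflexivity.
have D_near z : cyl r z -> forall i j,
    `|D z i j - (3 / 4 * d) * (i == j)%:R| <= (3 / 4 * d) / 20.
  move=> zK i j; rewrite mxE; apply: le_trans (_ : d / 40 <= _); last by lra.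
  rewrite -normrN; apply: le_trans (hy i j z zK); rewrite le_eqVlt.
  by apply/orP; left; apply/eqP; congr (`|_|); field.
have d34 : 0 <= 3 / 4 * d by lra.
have coefP z k : cyl r z -> 0 <= prim_coef (D z) k <= 3 / 4 * d.
  by move=> zK; apply: prim_coef_bounds => // i j; exact: D_near.
have [y' [ey' yy' dy' hy']] := corrugation_steps r nat (iota 0 6)
  (fun k z => Num.sqrt (prim_coef (D z) k)) prim_dir _ _ _ e0 ec m5 ey
  (fun k => contK_sqrt _ _ (contK_prim_coef _ k cD)).
exists y'; split; [exact: ey'|exact: yy'| |].
- move=> i z zK; apply: le_trans (dy' i z zK) _; rewrite lerD2r.
  have -> : 6 * Num.sqrt d = \sum_(k <- iota 0 6) Num.sqrt d.
    by rewrite big_const_seq /= addr0; ring.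
  apply: ler_sum => k _; rewrite -[leRHS]mulr1.
  apply: ler_pM; rewrite ?normr_ge0 ?prim_dir_le1//.
  rewrite ger0_norm ?sqrtr_ge0// ler_sqrt ?(ltW d0)//.
  by have /andP[_ h] := coefP z k zK; apply: (le_trans h); lra.
- move=> i j z zK; apply: le_trans (hy' i j z zK).
  have -> : \sum_(k <- iota 0 6) Num.sqrt (prim_coef (D z) k) ^+ 2
      * (prim_dir k 0 i * prim_dir k 0 j) = D z i j.
    rewrite -(prim_decomposition (D z) (fun i j => sD z i j zK)).
    by apply: eq_bigr => k _; rewrite sqr_sqrtr//; have /andP[] := coefP z k zK.
  rewrite mxE le_eqVlt; apply/orP; left; apply/eqP; congr (`|_|).
  by rewrite [in LHS]opprB; ring.
Qed.

End Stage.

(** * Filling an arbitrary positive definite deficit *)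

Section FirstStage.
Context {R : realType}.
Local Notation Z := (R * 'rV[R]_3)%type.
Local Notation i2 := (2%:R : 'I_3).

Definition row3l (x y z : R) : 'rV[R]_3 := \row_l nth 0 [:: x; y; z] l.

Lemma quadform_row3l (A : 'M[R]_3) x y z : (forall i j, A i j = A j i) ->
  quadform A (row3l x y z) = A 0 0 * x ^+ 2 + A 1 1 * y ^+ 2 + A i2 i2 * z ^+ 2
    + 2 * A 0 1 * x * y + 2 * A 0 i2 * x * z + 2 * A 1 i2 * y * z.
Proof.
move=> sA; rewrite /quadform !big_ord_recl !big_ord0 !mxE /=.
have -> : lift ord0 ord0 = 1 :> 'I_3 by exact: val_inj.
have -> : lift ord0 (lift ord0 ord0) = i2 :> 'I_3 by exact: val_inj.
have -> : ord0 = 0 :> 'I_3 by [].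
by rewrite (sA 1 0) (sA i2 0) (sA i2 1); ring.
Qed.

(** Cholesky factorisation. The pivots [a], [d], [f] are values of the form at nonzero vectors,
    those minimising it once the last nonzero coordinate is set to [1], hence positive; the rows of
    the triangular factor are the [nu l]. *)
Lemma posdef_sum_of_squares (A : 'M[R]_3) : (forall i j, A i j = A j i) ->
  (forall v : 'rV[R]_3, v != 0 -> 0 < quadform A v) ->
  exists nu : nat -> 'rV[R]_3, forall i j,
    A i j = \sum_(l <- iota 0 3) nu l 0 i * nu l 0 j.
Proof.
move=> sA pA.
have pos x y z : (x != 0) || (y != 0) || (z != 0) -> 0 < quadform A (row3l x y z).
  move=> xyz; apply: pA; apply: contraL xyz => /eqP/rowP h.
  have := h 0; have := h 1; have := h i2; rewrite !mxE /= => -> -> ->.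
  by rewrite eqxx.
pose a := A 0 0; pose b := A 0 1; pose c := A 0 i2.
have a0 : 0 < a.
  have := pos 1 0 0; rewrite oner_eq0 => /(_ isT); rewrite quadform_row3l//.
  by rewrite -/a; lra.
pose d := A 1 1 - b ^+ 2 / a; pose e := A 1 i2 - b * c / a.
have d0 : 0 < d.
  have := pos (- b / a) 1 0; rewrite oner_eq0 orbT => /(_ isT).
  rewrite quadform_row3l// -/a -/b -/c.
  suff -> : a * (- b / a) ^+ 2 + A 1 1 * 1 ^+ 2 + A i2 i2 * 0 ^+ 2
    + 2 * b * (- b / a) * 1 + 2 * c * (- b / a) * 0 + 2 * A 1 i2 * 1 * 0 = d by [].
  by rewrite /d; field; rewrite gt_eqF.
pose f := A i2 i2 - c ^+ 2 / a - e ^+ 2 / d.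
have f0 : 0 < f.
  pose y := - e / d; pose x := - (b * y + c) / a.
  have := pos x y 1; rewrite oner_eq0 orbT => /(_ isT).
  rewrite quadform_row3l// -/a -/b -/c.
  have -> : A 1 1 = d + b ^+ 2 / a by rewrite /d subrK.
  have -> : A 1 i2 = e + b * c / a by rewrite /e subrK.
  suff -> : a * x ^+ 2 + (d + b ^+ 2 / a) * y ^+ 2 + A i2 i2 * 1 ^+ 2
    + 2 * b * x * y + 2 * c * x * 1 + 2 * (e + b * c / a) * y * 1 = f by [].
  move: (d) (e) d0 @y @x @f => D E D0 y x f.
  by rewrite /f /x /y; field; rewrite !gt_eqF.
pose sa := Num.sqrt a; pose sd := Num.sqrt d; pose sf := Num.sqrt f.
have saE : sa ^+ 2 = a by rewrite sqr_sqrtr ?ltW.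
have sdE : sd ^+ 2 = d by rewrite sqr_sqrtr ?ltW.
have sfE : sf ^+ 2 = f by rewrite sqr_sqrtr ?ltW.
have sa0 : sa != 0 by rewrite gt_eqF// sqrtr_gt0.
have sd0 : sd != 0 by rewrite gt_eqF// sqrtr_gt0.
exists (fun l => nth 0 [:: row3l sa (b / sa) (c / sa); row3l 0 sd (e / sd);
  row3l 0 0 sf] l).
have A11 : A 1 1 = sd ^+ 2 + b ^+ 2 / sa ^+ 2 by rewrite sdE saE /d subrK.
have A12 : A 1 i2 = e + b * c / sa ^+ 2 by rewrite saE /e subrK.
have A22 : A i2 i2 = sf ^+ 2 + e ^+ 2 / sd ^+ 2 + c ^+ 2 / sa ^+ 2.
  by rewrite sfE sdE saE /f; ring.
have A00 : A 0 0 = sa ^+ 2 by rewrite saE.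
rewrite /= => i j; rewrite !big_cons big_nil /=.
move: (e) A11 A12 A22 => e' A11 A12 A22.
move: i j; apply: ord3_cases; apply: ord3_cases; rewrite !mxE /=;
  rewrite ?(sA 1 0) ?(sA i2 0) ?(sA i2 1) ?A00 ?A11 ?A12 ?A22;
  rewrite -?/b -?/c; field; by rewrite ?sa0 ?sd0.
Qed.

Context {m : nat}.
Variable r : R.

(** The six fixed directions could need negative coefficients here. Instead each sampled matrix
    [P c'] is split into three squares, and the partition functions spread these: finitely many
    twists with constant directions [nu c' l] and amplitudes [Num.sqrt (phi c' z)]. *)
Lemma corrugation_first_stage (G : Z -> 'M[R]_3) (c k e : R) (y : Z -> 'rV[R]_m) :
  (5 <= m)%N -> contK r G -> (forall z i j, cyl r z -> G z i j = G z j i) ->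
  0 < k -> 0 < e -> e < c -> expanding r c y ->
  (forall z v, cyl r z -> v != 0 ->
    0 < quadform (\matrix_(i, j) (G z i j - dotv (dx i y z) (dx j y z)
                                  - k * (i == j)%:R)) v) ->
  exists y', [/\ expanding r (c - e) y',
    forall z, cyl r z -> enorm (y' z - y z) <= e &
    forall i j z, cyl r z ->
      `|dotv (dx i y' z) (dx j y' z) - (G z i j - k * (i == j)%:R)| <= k / 40].
Proof.
move=> m5 cG sG k0 e0 ec ey pos; have [[_ _ cdy] _ _] := ey.
pose P z : 'M[R]_3 := \matrix_(i, j)
  (G z i j - dotv (dx i y z) (dx j y z) - k * (i == j)%:R).
have PE z i j : P z i j = G z i j - dotv (dx i y z) (dx j y z) - k * (i == j)%:R.
  by rewrite mxE.
have cP : contK r P.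
  apply/contK_mxP => i j; under eq_fun do rewrite PE.
  have cGij := (contK_mxP _ _).1 cG i j.
  exact: contKB _ _ _ (contKB _ _ _ cGij (contK_dotv _ _ _ (cdy i) (cdy j)))
    (contK_cst _ _).
have sP z i j : cyl r z -> P z i j = P z j i.
  by move=> zK; rewrite !PE (sG z i j zK) (eq_sym i) (dotvC (dx i y z)).
have k80 : 0 < k / 80 by rewrite divr_gt0.
have [s [phi [sK Cphi phi0 Pphi]]] := approx_by_partition _ _ _ cP k80.
have /choice[nu nuP] (c' : Z) : exists nu : nat -> 'rV[R]_3, cyl r c' ->
    forall i j, P c' i j = \sum_(l <- iota 0 3) nu l 0 i * nu l 0 j.
  have [cK|] := pselect (cyl r c'); last by exists (fun=> 0).
  have [nu nuP] := posdef_sum_of_squares _ (fun i j => sP c' i j cK)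
    (fun v => pos c' v cK).
  by exists nu.
(* Sampling and twisting each cost [k / 80], so the outcome meets the tolerance [d / 40] of
   [corrugation_stage] with [d = k]. *)
pose e1 := Num.min e (k / 80).
have e10 : 0 < e1 by rewrite lt_min e0.
have e1e : e1 <= e by rewrite ge_min lexx.
have e1k : e1 <= k / 80 by rewrite ge_min lexx orbT.
have ca (p : Z * nat) : contK r (fun z => Num.sqrt (phi p.1 z)).
  by apply: contK_sqrt; have [_ h _] := Cphi p.1; exact: h.
have [y' [ey' yy' _ hy']] := corrugation_steps r _
  [seq (c', l) | c' <- s, l <- iota 0 3] _ (fun p => nu p.1 p.2) _ _ _ e10
  (le_lt_trans e1e ec) m5 ey ca.
have cc : c - e <= c - e1 by rewrite lerD2l lerN2.
exists y'; split.
- exact: expanding_le cc ey'.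
- by move=> z zK; apply: le_trans e1e; exact: yy'.
move=> i j z zK; have := hy' i j z zK; rewrite big_allpairs /=.
have -> : \sum_(c' <- s) \sum_(l <- iota 0 3)
    Num.sqrt (phi c' z) ^+ 2 * (nu c' l 0 i * nu c' l 0 j) =
    (\sum_(c' <- s) phi c' z *: P c') i j.
  rewrite summxE big_seq [RHS]big_seq; apply: eq_bigr => c' c's.
  rewrite [RHS]mxE (nuP c' (sK _ c's)) mulr_sumr; apply: eq_bigr => l _.
  by rewrite sqr_sqrtr// phi0.
have := le_trans (ler_entry_norm _ i j) (Pphi z zK).
set S := \sum_(_ <- _) _; rewrite [(P z - S) i j]mxE [(- S) i j]mxE PE.
move: (dotv _ _) (dotv _ _) (S i j) (G z i j) (k * _) => X0 X1 S' G' k'.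
move=> a1 a2.
have -> : X0 - (G' - k') = (X0 - X1 - S') - (G' - X1 - k' - S') by ring.
have -> : k / 40 = k / 80 + k / 80 by field.
rewrite (le_trans (ler_normB _ _))// lerD//.
exact: le_trans a2 e1k.
Qed.

End FirstStage.

(** * Limits of geometrically converging sequences *)

Section GeometricLimits.
Context {R : realType}.

Lemma geometric_small (C e : R) : 0 < e -> exists q : nat, C * 2^-1 ^+ q < e.
Proof.
move=> e0; exists (Num.truncn (`|C| / e)).+1.
rewrite exprVn ltr_pdivrMr ?exprn_gt0// mulrC -ltr_pdivrMr//.
apply: le_lt_trans (_ : `|C| / e < _).
  by rewrite ler_wpM2r ?invr_ge0 ?(ltW e0)// ler_norm.
apply: lt_trans (truncnS_gt _) _.
by rewrite -natrX ltr_nat ltn_expl.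
Qed.

Lemma geometric_le (C a b : R) : (forall q, a <= b + C * 2^-1 ^+ q) -> a <= b.
Proof.
move=> h; apply/ler_addgt0Pr => e e0.
have [q qe] := geometric_small C _ e0.
by apply: le_trans (h q) _; rewrite lerD2l ltW.
Qed.

Lemma geometric_cvg {m : nat} (u : nat -> 'rV[R]_m) (C : R) : 0 <= C ->
  (forall q, `|u q.+1 - u q| <= C * 2^-1 ^+ q) ->
  exists l, forall q, `|u q - l| <= 2 * C * 2^-1 ^+ q.
Proof.
move=> C0 hu.
have h q k : `|u q - u (q + k)%N| <= 2 * C * (2^-1 ^+ q - 2^-1 ^+ (q + k)).
  elim: k => [|k ih]; first by rewrite addn0 !subrr normr0 mulr0.
  rewrite -(subrKA (u (q + k)%N)) (le_trans (ler_normD _ _))//.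
  rewrite addnS; have := hu (q + k)%N; rewrite distrC => h.
  apply: le_trans (lerD ih h) _; rewrite exprS le_eqVlt; apply/orP; left.
  by apply/eqP; field.
have {}h q n : (q <= n)%N -> `|u q - u n| <= 2 * C * 2^-1 ^+ q.
  move=> qn; rewrite -(subnKC qn); apply: le_trans (h _ _) _.
  by rewrite ler_wpM2l ?mulr_ge0// lerBlDr lerDl exprn_ge0.
have : cauchy (u @ \oo).
  apply: cauchy_exP => e e0; have [q qe] := geometric_small (2 * C) _ e0.
  exists (u q); exists q => // n /= qn; rewrite -ball_normE /=.
  exact: le_lt_trans (h _ _ qn) qe.
move=> /cauchy_cvg ucvg; exists (lim (u @ \oo)) => q.
apply/ler_addgt0Pr => e e0.
have /cvgrPdist_lt/(_ _ e0) [N _ NP] := ucvg.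
have := NP (maxn N q) (leq_maxl _ _) => /= hl.
rewrite -(subrKA (u (maxn N q))) (le_trans (ler_normD _ _))//.
by rewrite lerD ?h ?leq_maxr// distrC ltW.
Qed.

Lemma continuous_mulmxr {n m : nat} (A : 'M[R]_(n, m)) :
  continuous (fun v : 'rV[R]_n => v *m A : 'rV[R]_m).
Proof.
move=> v; have FF : Filter (nbhs v) := nbhs_filter v.
apply/cvgrPdist_lt => e e0.
have C0 : 0 < n%:R * `|A| + 1 by rewrite ltr_wpDl// mulr_ge0.
have d0 : 0 < e / (n%:R * `|A| + 1) by rewrite divr_gt0.
apply: (@filterS _ _ FF _ _ _ (nbhsx_ballx v _ d0)) => w.
rewrite -ball_normE /= => vw.
rewrite -mulmxBl; apply: le_lt_trans (ler_norm_mulmx _ _) _.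
apply: (@le_lt_trans _ _ ((n%:R * `|A| + 1) * `|v - w|)).
  by rewrite mulrAC ler_wpM2r// lerDl.
by rewrite mulrC -ltr_pdivlMr.
Qed.

Lemma differentiable_of_estimate {V W : normedModType R} (f : V -> W) x
    (L : {linear V -> W}) : continuous L ->
  (forall e, 0 < e -> exists2 d, 0 < d &
     forall h, `|h| < d -> `|f (h + x) - f x - L h| <= e * `|h|) ->
  differentiable f x /\ 'd f x = L :> (V -> W).
Proof.
move=> cL hf.
have fL : f \o shift x = cst (f x) + L +o_ 0 id.
  apply/eqaddoP => e e0; have [d d0 dP] := hf _ e0.
  apply/nbhs_ballP; exists d => // h; rewrite -ball_normE /= sub0r normrN => hd.
  rewrite fctE /= opprD addrA; exact: dP.
have dE : 'd f x = L :> (_ -> _) by exact: diff_unique.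
split=> //; by apply/diff_locallyP; rewrite dE.
Qed.

End GeometricLimits.

Section UniformLimits.
Context {R : realType} {n m : nat}.
Local Notation Z := (R * 'rV[R]_n)%type.
Variable r : R.

Lemma contK_geometric_limit (f : nat -> Z -> 'rV[R]_m) (g : Z -> 'rV[R]_m) C :
  (forall q, contK r (f q)) ->
  (forall q z, cyl r z -> `|f q z - g z| <= C * 2^-1 ^+ q) -> contK r g.
Proof.
move=> cf fg z zK; apply/cvgrPdist_lt => e e0.
have e30 : 0 < e / 3 by rewrite divr_gt0.
have [q qe] := geometric_small C _ e30.
have /cvgrPdist_lt/(_ _ e30) h := cf q z zK.
near=> w.
have wK : cyl r w by near: w; exact: withinT.
have h1 : `|g z - f q z| < e / 3 by rewrite distrC (le_lt_trans (fg q z zK)).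
have h2 : `|f q w - g w| < e / 3 by rewrite (le_lt_trans (fg q w wK)).
have h3 : `|f q z - f q w| < e / 3 by near: w; exact: h.
rewrite -(subrKA (f q z)) (le_lt_trans (ler_normD _ _))//.
have := ler_normD (f q z - f q w) (f q w - g w); rewrite subrKA; lra.
Unshelve. all: by end_near. Qed.

(** The mean value estimate is applied to each [f q] with the limit derivatives [D] at [(t, x)] as
    reference; its error is the oscillation of [D] plus [C * 2^-1 ^+ q], and the latter vanishes as
    [q] grows. [|x| < r] is strict so that small increments stay in the cylinder. *)
Lemma differentiable_geometric_limit (f : nat -> Z -> 'rV[R]_m)
    (g : Z -> 'rV[R]_m) (D : 'I_n -> Z -> 'rV[R]_m) C : 0 <= C ->
  (forall q, C1K r (f q)) ->
  (forall q z, cyl r z -> `|f q z - g z| <= C * 2^-1 ^+ q) ->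
  (forall q i z, cyl r z -> `|dx i (f q) z - D i z| <= C * 2^-1 ^+ q) ->
  forall t x, `|t| <= r -> `|x| < r ->
    differentiable (fun x => g (t, x)) x /\ forall i, dx i g (t, x) = D i (t, x).
Proof.
move=> C0 Cf fg dfD t x tr xr.
have cD i : contK r (D i).
  apply: (contK_geometric_limit (fun q => dx i (f q)) _ C).
    by move=> q; have [_ _] := Cf q; exact.
  by move=> q z zK; exact: dfD.
pose A : 'M[R]_(n, m) := \matrix_i D i (t, x).
have cylE u : cyl r (t, u) <-> `|u| <= r.
  by rewrite /cyl /= prod_normE /= ge_max tr.
have xK : cyl r (t, x) by apply/cylE; exact: ltW.
have [df dg] : differentiable (fun x => g (t, x)) x /\
    'd (fun x => g (t, x)) x = mulmxr A :> (_ -> _).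
  apply: differentiable_of_estimate => [|e e0]; first exact: continuous_mulmxr.
  pose w := e / n.+1%:R; have w0 : 0 < w by rewrite divr_gt0.
  have cV : contK r (fun z => \matrix_i D i z).
    apply/contK_mxP => i k; under eq_fun do rewrite mxE.
    exact: (contK_mxP _ _).1 (cD i) 0 k.
  have [d d0 dP] := contK_unif _ _ cV _ w0.
  exists (Num.min d (r - `|x|)); first by rewrite lt_min d0 subr_gt0.
  move=> h; rewrite lt_min => /andP[hd hr].
  have hxK : cyl r (t, h + x).
    by apply/cylE; rewrite (le_trans (ler_normD _ _))// -lerBrDr ltW.
  have hq q : `|f q (t, h + x) - f q (t, x) - h *m A|
      <= n%:R * (w + C * 2^-1 ^+ q) * `|h|.
    have wq0 : 0 <= w + C * 2^-1 ^+ q.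
      by rewrite addr_ge0 ?(ltW w0)// mulr_ge0// exprn_ge0.
    have -> : h *m A = \sum_i (h + x - x) 0 i *: D i (t, x).
      rewrite addrK mulmx_sum_row; apply: eq_bigr => i _; congr (_ *: _).
      by apply/rowP => k; rewrite !mxE.
    rewrite -[X in _ * `|X|](addrK x).
    apply: (C1K_mvt_estimate _ _ _ _ _ (fun i => D i (t, x)) _ wq0 (Cf q) xK hxK).
    move=> x'' i x''K; rewrite addrK => x''x.
    rewrite -(subrKA (D i (t, x''))) addrC (le_trans (ler_normD _ _))// addrC.
    rewrite addrC lerD//; last exact: dfD.
    have : `|(t, x'') - (t, x)| < d.
      by rewrite prod_normE /= subrr normr0 gt_max d0 (le_lt_trans x''x).
    move=> /(dP _ _ x''K xK)/ltW; apply: le_trans.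
    apply: ler_norm_entries => // a k; rewrite (ord1 a).
    have := ler_entry_norm (\matrix_i D i (t, x'') - \matrix_i D i (t, x)) i k.
    by rewrite !mxE.
  have hg : `|g (t, h + x) - g (t, x) - h *m A| <= n%:R * w * `|h|.
    apply: (geometric_le (2 * C + n%:R * C * `|h|)) => q.
    have h1 := fg q _ hxK; have h2 := fg q _ xK; have h3 := hq q.
    have -> : g (t, h + x) - g (t, x) - h *m A =
        (f q (t, h + x) - f q (t, x) - h *m A)
        - (f q (t, h + x) - g (t, h + x)) + (f q (t, x) - g (t, x)).
      by apply/rowP => k; rewrite !mxE; ring.
    rewrite (le_trans (ler_normD _ _))//.
    rewrite (le_trans (lerD (ler_normB _ _) (lexx _)))//.
    apply: le_trans (lerD (lerD h3 h1) h2) _.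
    by rewrite le_eqVlt; apply/orP; left; apply/eqP; ring.
  apply: le_trans hg _; rewrite ler_wpM2r// /w mulrCA ler_piMr ?(ltW e0)//.
  by rewrite ler_pdivrMr// mul1r ler_nat.
split=> // i; rewrite /dx /partial deriveE// dg /= -rowE.
by apply/rowP => k; rewrite !mxE.
Qed.

End UniformLimits.

(** * Iteration of the stages *)

Section LocalNashKuiper.
Context {R : realType} {m : nat}.
Local Notation Z := (R * 'rV[R]_3)%type.
Variable r : R.

Lemma pointwise_geometric_cvg (f : nat -> Z -> 'rV[R]_m) (C : R) : 0 <= C ->
  (forall q z, cyl r z -> `|f q.+1 z - f q z| <= C * 2^-1 ^+ q) ->
  exists g, forall q z, cyl r z -> `|f q z - g z| <= 2 * C * 2^-1 ^+ q.
Proof.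
move=> C0 hf.
have /choice[g gP] (z : Z) : exists l, cyl r z ->
    forall q, `|f q z - l| <= 2 * C * 2^-1 ^+ q.
  have [zK|] := pselect (cyl r z); last by exists 0.
  have [l lP] := geometric_cvg (fun q => f q z) C C0 (fun q => hf q z zK).
  by exists l.
by exists g => q z zK; exact: gP.
Qed.

(** With [h q = 2^-q], stage [q] has amplitudes of order [Num.sqrt k * h q], so the derivatives
    converge, while the expansion constant [c / 2 + c / 4 * h q] never falls below [c / 2]. The
    limit derivatives are returned as [D]: they are continuous up to the boundary of the cylinder,
    but identified with derivatives of [Y] only where [|x| < r]. *)
Lemma local_nash_kuiper (G : Z -> 'M[R]_3) (c k eps : R) (y : Z -> 'rV[R]_m) :
  (5 <= m)%N -> contK r G -> (forall z i j, cyl r z -> G z i j = G z j i) ->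
  0 < c -> 0 < k -> 0 < eps -> expanding r c y ->
  (forall z v, cyl r z -> v != 0 ->
    0 < quadform (\matrix_(i, j) (G z i j - dotv (dx i y z) (dx j y z)
                                  - k * (i == j)%:R)) v) ->
  exists (Y : Z -> 'rV[R]_m) (D : 'I_3 -> Z -> 'rV[R]_m),
    [/\ contK r Y /\ forall i, contK r (D i),
        forall z, cyl r z -> `|Y z - y z| <= eps,
        forall t x, `|t| <= r -> `|x| < r ->
          differentiable (fun x => Y (t, x)) x /\
          forall i, dx i Y (t, x) = D i (t, x),
        forall z i j, cyl r z -> dotv (D i z) (D j z) = G z i j &
        forall t x x', cyl r (t, x) -> cyl r (t, x') ->
          c / 2 * `|x - x'| <= enorm (Y (t, x) - Y (t, x'))].
Proof.
move=> m5 cG sG c0 k0 eps0 ey pos.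
pose h q : R := 2^-1 ^+ q; pose d q : R := k * h q ^+ 2.
have h0 q : 0 < h q by rewrite exprn_gt0.
have hS q : h q.+1 = h q / 2 by rewrite /h exprS mulrC.
have h1 q : h q <= 1 by apply: exprn_ile1; lra.
have d0 q : 0 < d q by rewrite mulr_gt0// exprn_gt0.
have dS q : d q.+1 = d q / 4 by rewrite /d hS; field.
pose S q (f : Z -> 'rV[R]_m) := expanding r (c / 2 + c / 4 * h q) f /\
  forall i j z, cyl r z ->
    `|dotv (dx i f z) (dx j f z) - (G z i j - d q * (i == j)%:R)| <= d q / 40.
pose C := 6 * Num.sqrt k + eps / 4.
have C0 : 0 < C by rewrite ltr_wpDl// ?divr_gt0// mulr_ge0// sqrtr_ge0.
have step (p : nat * (Z -> 'rV[R]_m)) : exists f', S p.1 p.2 -> [/\ S p.1.+1 f',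
    forall z, cyl r z -> `|f' z - p.2 z| <= eps / 4 * h p.1 &
    forall i z, cyl r z -> `|dx i f' z - dx i p.2 z| <= C * h p.1].
  case: p => q f /=; have [[ef hf]|nS] := pselect (S q f); last by exists f => /nS.
  (* The three bounds are the loss of expansion allowed from [h q] to [h q.+1], the displacement
     allowed at stage [q], and the next metric tolerance [d q.+1 / 40]. *)
  pose e := Num.min (Num.min (c / 8 * h q) (eps / 4 * h q)) (d q / 160).
  have e0 : 0 < e by rewrite !lt_min !mulr_gt0 ?divr_gt0//= mulr_gt0.
  have [e1 [e2 e3]] : e <= c / 8 * h q /\ e <= eps / 4 * h q /\ e <= d q / 160.
    by rewrite !ge_min !lexx !orbT.
  clearbody e; have ch : 0 < c * h q by rewrite mulr_gt0.
  have ec : e < c / 2 + c / 4 * h q by lra.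
  have [f' [ef' ff' df' hf']] := corrugation_stage r G _ _ _ _ m5 cG sG
    (d0 q) e0 ec ef hf.
  exists f' => _; split.
  - split; first by apply: expanding_le ef'; rewrite hS; lra.
    move=> i j z zK; rewrite dS; apply: le_trans (hf' i j z zK) _.
    by apply: le_trans e3 _; lra.
  - move=> z zK; apply: le_trans (norm_le_enorm _) _.
    exact: le_trans (ff' z zK) e2.
  - move=> i z zK; apply: le_trans (norm_le_enorm _) _.
    apply: (le_trans (df' i z zK)).
    rewrite /C [leRHS]mulrDl; apply: lerD => //.
    by rewrite /d sqrtrM ?(ltW k0)// sqrtr_sqr (gtr0_norm (h0 q)) mulrA.
have /choice[F FP] := step.
(* Losing at most [c / 4] leaves [3 / 4 * c], which is [c / 2 + c / 4 * h 0]. The other half of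
   [eps] is left for the later stages, whose displacements [eps / 4 * h q] sum to [eps / 2]. *)
pose e0 := Num.min (eps / 2) (c / 4).
have e00 : 0 < e0 by rewrite lt_min !divr_gt0.
have e0c4 : e0 <= c / 4 by rewrite ge_min lexx orbT.
have e0e : e0 <= eps / 2 by rewrite ge_min lexx.
have e0c : e0 < c by lra.
have [f0 [ef0 yf0 hf0]] := corrugation_first_stage r G _ _ _ _ m5 cG sG k0 e00
  e0c ey pos.
pose f := fix f q := if q is q'.+1 then F (q', f q') else f0.
have Sf q : S q (f q).
  elim: q => [|q ih]; last by have [] := FP (q, f q) ih.
  rewrite /S /d /h expr0 expr1n !mulr1; split; last exact: hf0.
  by apply: expanding_le ef0; lra.
have ff q z : cyl r z -> `|f q.+1 z - f q z| <= eps / 4 * h q.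
  by move=> zK; have [_ + _] := FP (q, f q) (Sf q); exact.
have dff q i z : cyl r z -> `|dx i (f q.+1) z - dx i (f q) z| <= C * h q.
  by move=> zK; have [_ _] := FP (q, f q) (Sf q); exact.
have eps40 : 0 <= eps / 4 by rewrite divr_ge0// ltW.
have [Y YP] := pointwise_geometric_cvg f _ eps40 ff.
have /choice[D DP] i : exists D, forall q z, cyl r z ->
    `|dx i (f q) z - D z| <= 2 * C * h q.
  exact: (pointwise_geometric_cvg (fun q => dx i (f q)) _ (ltW C0)
    (fun q z => dff q i z)).
have Cf q : C1K r (f q) by have [[]] := Sf q.
have C2 : 0 <= 2 * C by rewrite mulr_ge0// ltW.
have fY q z : cyl r z -> `|f q z - Y z| <= 2 * C * h q.
  move=> zK; apply: le_trans (YP q z zK) _.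
  by rewrite ler_wpM2r ?(ltW (h0 q))// ler_wpM2l// lerDr mulr_ge0// sqrtr_ge0.
exists Y, D; split.
- split=> [|i].
    apply: (contK_geometric_limit _ f _ (2 * C)) => // q.
    by have [_ cf _] := Cf q; exact: cf.
  apply: (contK_geometric_limit _ (fun q => dx i (f q)) _ (2 * C)) => [q|q z zK].
    by have [_ _ cf] := Cf q; exact: cf.
  exact: DP.
- move=> z zK; rewrite -(subrKA (f0 z)) (le_trans (ler_normD _ _))// (splitr eps).
  apply: lerD; last exact: le_trans (norm_le_enorm _) (le_trans (yf0 z zK) e0e).
  by rewrite distrC; have := YP 0%N z zK; rewrite expr0 mulr1 /=; lra.
- apply: (differentiable_geometric_limit _ f Y D (2 * C)) => // q i z zK.
  exact: DP.
(* The metric at stage [q] differs from the limit metric and from [G] by multiples of [h q], with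
   factors independent of [q]. *)
- move=> z i j zK; apply/eqP; rewrite -subr_eq0 -normr_le0.
  pose s := m%:R * (2 * C).
  have s0 : 0 <= s by rewrite mulr_ge0.
  have err l q : enorm (dx l (f q) z - D l z) <= s * h q.
    by rewrite (le_trans (enorm_le_norm _))// -mulrA ler_wpM2l// DP.
  apply: (geometric_le ((enorm (D i z) + enorm (D j z) + s) * s + 2 * k)) => q.
  rewrite add0r -/(h q).
  pose u := dx i (f q) z - D i z; pose v := dx j (f q) z - D j z.
  have ue : enorm u <= s * h q by exact: err.
  have ve : enorm v <= s * h q by exact: err.
  have [_ /(_ i j z zK)] := Sf q.
  have -> : dx i (f q) z = D i z + u by rewrite /u addrC subrK.
  have -> : dx j (f q) z = D j z + v by rewrite /v addrC subrK.
  clearbody u v; rewrite dotvDl !dotvDr => hq.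
  have cs1 := le_trans (cauchy_schwarz (D i z) v) (ler_wpM2l (enorm_ge0 _) ve).
  have cs2 := le_trans (cauchy_schwarz u (D j z)) (ler_wpM2r (enorm_ge0 _) ue).
  have cs3 : `|dotv u v| <= s * h q * s.
    apply: le_trans (cauchy_schwarz u v) _; apply: ler_pM; rewrite ?enorm_ge0//.
    by apply: le_trans ve _; rewrite ler_piMr.
  have dk : `|d q * (i == j)%:R| <= d q.
    by rewrite normrM (gtr0_norm (d0 q)) ler_piMr ?(ltW (d0 q))//; case: (i == j);
      rewrite ?normr1 ?normr0.
  have dkh : d q <= k * h q by rewrite /d expr2 mulrA ler_piMr// ltW// mulr_gt0.
  have d40 : d q / 40 <= d q by have := d0 q; lra.
  move: (dotv (D i z) (D j z)) (dotv (D i z) v) (dotv u (D j z)) (dotv u v) hq cs1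
    cs2 cs3 => A0 A1 A2 A3 hq cs1 cs2 cs3.
  have -> : A0 - G z i j = (A0 + A1 + (A2 + A3) - (G z i j - d q * (i == j)%:R))
      - A1 - A2 - A3 - d q * (i == j)%:R by ring.
  have -> : ((enorm (D i z) + enorm (D j z) + s) * s + 2 * k) * h q =
    k * h q + enorm (D i z) * (s * h q) + s * h q * enorm (D j z) + s * h q * s
    + k * h q by ring.
  apply: le_trans (ler_normB _ _) _; apply: lerD; last exact: le_trans dk dkh.
  apply: le_trans (ler_normB _ _) _; apply: lerD; last exact: cs3.
  apply: le_trans (ler_normB _ _) _; apply: lerD; last exact: cs2.
  apply: le_trans (ler_normB _ _) _; apply: lerD; last exact: cs1.
  exact: le_trans hq (le_trans d40 dkh).
- move=> t x x' xK x'K; apply: (geometric_le (2 * (m%:R * (2 * C)))) => q.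
  rewrite -/(h q); have [[_ _ /(_ t x x' xK x'K) hl] _] := Sf q.
  have n1 := le_trans (enorm_le_norm _) (ler_wpM2l (ler0n R m) (fY q _ xK)).
  have n2 := le_trans (enorm_le_norm _) (ler_wpM2l (ler0n R m) (fY q _ x'K)).
  have t1 : enorm (f q (t, x) - f q (t, x')) <= enorm (Y (t, x) - Y (t, x'))
      + enorm (f q (t, x) - Y (t, x)) + enorm (f q (t, x') - Y (t, x')).
    have -> : f q (t, x) - f q (t, x') = (Y (t, x) - Y (t, x'))
        + (f q (t, x) - Y (t, x)) - (f q (t, x') - Y (t, x')).
      by apply/rowP => l; rewrite !mxE; ring.
    apply: le_trans (ler_enormB _ _) _; rewrite lerD2r; exact: ler_enormD.
  have t2 : c / 2 * `|x - x'| <= (c / 2 + c / 4 * h q) * `|x - x'|.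
    by rewrite ler_wpM2r// lerDl mulr_ge0 ?(ltW (h0 q))// divr_ge0// ltW.
  apply: le_trans t2 _; apply: le_trans hl _; apply: le_trans t1 _.
  rewrite -addrA lerD2l; apply: le_trans (lerD n1 n2) _.
  by rewrite le_eqVlt; apply/orP; left; apply/eqP; ring.
Qed.

End LocalNashKuiper.

(** * The shear metric *)

Section ShearMetric.
Context {R : realType}.

(** Near [s], and for either sign of the endpoint, the oriented integral is [F x - F 0], where [F]
    integrates from the fixed point [- L] to the left of both [s] and [0]; [F] is differentiable at
    [s] by the fundamental theorem of calculus. *)
Lemma continuous_integral_from0 (h : R -> R) :
  continuous h -> continuous (integral_from0 h).
Proof.
move=> ch s; pose L := `|s| + 1.
have L0 : 0 < L by rewrite ltr_wpDl.
have /andP[Ls sL] : - L < s < L.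
  by rewrite -ltr_norml ltrDl.
have ih : (@lebesgue_measure R).-integrable `[- L, L] (EFin \o h).
  apply: continuous_compact_integrable; first exact: segment_compact.
  exact: continuous_subspaceT.
pose F x := \int[@lebesgue_measure R]_(t in `[- L, x]) h t.
have [dF _] := continuous_FTC1_closed sL ih Ls (ch s).
have cF : {for s, continuous F}.
  by apply: differentiable_continuous; apply/derivable1_diffP.
have E x : - L < x < L -> F x - F 0 = integral_from0 h x.
  move=> /andP[Lx xL]; rewrite /integral_from0.
  have [x0|x0] := leP 0 x.
    have ihx : (@lebesgue_measure R).-integrable `[- L, x] (EFin \o h).
      apply: integrableS ih => //; apply: subset_itvl.
      by rewrite bnd_simp ltW.
    rewrite /F (Rintegral_itvB ihx) ?bnd_simp ?oppr_le0 ?(ltW L0)//.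
    rewrite Rintegral_itv_obnd_cbnd//; apply: integrableS ihx => //.
    by apply: subset_itvr; rewrite bnd_simp oppr_le0 ltW.
  have ih0 : (@lebesgue_measure R).-integrable `[- L, 0] (EFin \o h).
    apply: integrableS ih => //; apply: subset_itvl.
    by rewrite bnd_simp ltW.
  rewrite -opprB /F (Rintegral_itvB ih0) ?bnd_simp ?(ltW Lx) ?(ltW x0)//.
  rewrite Rintegral_itv_obnd_cbnd//; apply: integrableS ih0 => //.
  by apply: subset_itvr; rewrite bnd_simp ltW.
have Es : F s - F 0 = integral_from0 h s by apply: E; rewrite Ls.
rewrite /continuous_at -Es.
have : (fun x => F x - F 0) @ s --> F s - F 0.
  by apply: cvgB; [exact: cF|exact: cvg_cst].
apply: cvg_trans; apply: near_eq_cvg; near=> x; apply: E.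
by apply/andP; split; near: x; [exact: lt_nbhsr|exact: lt_nbhsl].
Unshelve. all: by end_near. Qed.

Lemma continuous_shear_slope (B : R) (w : R -> R) :
  continuous w -> continuous (shear_slope B w).
Proof.
move=> cw s; apply: cvgM; first exact: cvg_cst.
apply: continuous_comp; last exact: continuous_atan.
apply: cvgM; first exact: cvg_cst.
by apply: continuous_integral_from0 => x; apply: cvgM; exact: cw.
Qed.

Lemma contK_shear_metric (r B : R) (w : R -> R) : continuous w ->
  contK r (fun z : R * 'rV[R]_3 => shear_metric B w z.2).
Proof.
move=> cw; apply/contK_mxP => i j; under eq_fun do rewrite mxE.
case: (i != j); first exact: contK_cst.
case: (i == 1); last exact: contK_cst.
have cs : contK r (fun z : R * 'rV[R]_3 => shear_slope B w (z.2 0 1)).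
  have [_ cx _] := C1K_coord r (1 : 'I_3).
  by apply: (contK_comp _ _ (shear_slope B w)) cx => z _;
    exact: continuous_shear_slope.
by apply: contKD; [exact: contK_cst|exact: (contKM _ _ _ cs cs)].
Qed.

Lemma shear_metric_sym (B : R) (w : R -> R) x i j :
  shear_metric B w x i j = shear_metric B w x j i.
Proof. by rewrite !mxE eq_sym; case: eqVneq => // ->. Qed.

Lemma trace_shear_metric (B : R) (w : R -> R) x :
  \tr (shear_metric B w x) = 3 * B ^+ 2 + shear_slope B w (x 0 1) ^+ 2.
Proof.
rewrite /mxtrace !big_ord_recl big_ord0 !mxE !eqxx /=.
by rewrite addr0; ring.
Qed.

(** The arctangent bounds the slope by [|B| * (pi / 2)], and the domain is an open cube, of finite
    measure. *)
Lemma energy_fin_num (r B : R) (w : R -> R) : continuous w ->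
  integral3 [set x | `|x| < r] (fun x => \tr (shear_metric B w x))
    \is a fin_num.
Proof.
move=> cw; rewrite /integral3.
pose leb := @lebesgue_measure R.
pose S : set (R * R * R) := (`]- r, r[ `*` `]- r, r[) `*` `]- r, r[.
have -> : @row3 R @^-1` [set x | `|x| < r] = S.
  have row3E (q : R * R * R) : [/\ row3 q 0 0 = q.1.1, row3 q 0 1 = q.1.2 &
      row3 q 0 2%:R = q.2] by rewrite !mxE.
  apply/seteqP; split=> q /=.
    have [e0 e1 e2] := row3E q => qr.
    have lt i : `|row3 q 0 i| < r by exact: le_lt_trans (ler_entry_norm _ _ _) qr.
    have := lt 0; have := lt 1; have := lt 2%:R; rewrite e0 e1 e2 !ltr_norml.
    by rewrite /S /= !in_itv /= => -> -> ->.
  have [e0 e1 e2] := row3E q.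
  rewrite /S /= !in_itv /= -!ltr_norml => -[[h0 h1] h2].
  apply: (@le_lt_trans _ _ (Num.max (Num.max `|q.1.1| `|q.1.2|) `|q.2|)).
    apply: ler_norm_entries => [|a i]; first by rewrite !le_max !normr_ge0.
    rewrite (ord1 a); move: i; apply: ord3_cases; rewrite ?e0 ?e1 ?e2 !le_max lexx
      ?orbT//.
  by rewrite !gt_max h0 h1 h2.
have mS : measurable S by apply: measurableX => //; exact: measurableX.
have mI : leb `]- r, r[%classic \is a fin_num.
  by rewrite /leb lebesgue_measure_itv /=; case: ifP.
have muS : ((leb \x leb) \x leb)%E S \is a fin_num.
  rewrite product_measure1E//; last exact: measurableX.
  by rewrite fin_numM// [X in X \is a fin_num](product_measure1E) // fin_numM.
have cs := continuous_shear_slope B _ cw.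
pose M := (`|B| * (pi / 2)) ^+ 2.
have MP s : shear_slope B w s ^+ 2 <= M.
  rewrite -real_normK ?num_real// ler_sqr ?nnegrE ?mulr_ge0 ?divr_ge0 ?pi_ge0//.
  rewrite normrM ler_wpM2l// ler_norml ltW ?atan_gtNpi2//=.
  by rewrite ltW// atan_ltpi2.
have trE : (fun q : R * R * R => (\tr (shear_metric B w (row3 q)))%:E) =
    (fun q => (3 * B ^+ 2 + shear_slope B w q.1.2 ^+ 2)%:E).
  by apply/funext => q; rewrite trace_shear_metric mxE.
rewrite trE.
have ge0 (q : R * R * R) : (0 <= (3 * B ^+ 2 + shear_slope B w q.1.2 ^+ 2)%:E)%E.
  by rewrite lee_fin; exact: (addr_ge0 (mulr_ge0 (ler0n R 3) (sqr_ge0 B)) (sqr_ge0 _)).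
rewrite ge0_fin_numE; last by apply: integral_ge0 => q _; exact: ge0.
apply: (@le_lt_trans _ _ (\int[((leb \x leb) \x leb)%E]_(q in S)
    (cst (3 * B ^+ 2 + M)%:E) q)%E).
  apply: ge0_le_integral => //.
  - apply/measurable_EFinP; apply: measurable_funD; first exact: measurable_cst.
    apply: measurable_funX; apply: measurable_funTS.
    apply: measurableT_comp; first exact: continuous_measurable_fun.
    by apply: measurableT_comp; [exact: measurable_snd|exact: measurable_fst].
  - by move=> q _; rewrite lee_fin lerD2l.
rewrite integral_cst//.
rewrite -ge0_fin_numE ?fin_numM// mule_ge0// lee_fin.
exact: (addr_ge0 (mulr_ge0 (ler0n R 3) (sqr_ge0 B)) (sqr_ge0 _)).
Qed.

End ShearMetric.

(** * The initial map on a small cylinder *)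

Section InitialMap.
Context {R : realType} {n m : nat}.
Local Notation Z := (R * 'rV[R]_n)%type.

Lemma differentiable_pair_cst t (x : 'rV[R]_n) :
  differentiable (fun x : 'rV[R]_n => (t : R, x)) x.
Proof. by apply: differentiable_pair; [exact: differentiable_cst|exact: ex_diff]. Qed.

Lemma differentiable_total (f : Z -> 'rV[R]_m) z : differentiable f z ->
  differentiable (fun x => f (z.1, x)) z.2.
Proof.
case: z => t x df; have dp := differentiable_pair_cst t x.
exact: (differentiable_comp (f := fun x : 'rV[R]_n => (t, x)) dp df).
Qed.

(** Passes from regularity in space-time, as assumed of the given map, to the slicewise derivatives
    of [C1K]. *)
Lemma dx_total (f : Z -> 'rV[R]_m) i z : differentiable f z ->
  dx i f z = 'D_((0 : R), delta_mx 0 i) f z.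
Proof.
case: z => t x df; have dp := differentiable_pair_cst t x.
have dcst : differentiable (fun _ : 'rV[R]_n => t) x by exact: differentiable_cst.
have did : differentiable (fun x : 'rV[R]_n => x) x by exact: ex_diff.
have dfx := differentiable_total _ _ df.
rewrite /dx /partial (deriveE _ dfx) (deriveE _ df) /=.
have -> := diff_comp (f := fun x : 'rV[R]_n => (t, x)) (g := f) dp df.
rewrite /= (diff_pair dcst did) /=; congr ('d f (t, x) (_, _)).
  by rewrite diff_cst.
by rewrite diff_val.
Qed.

Lemma C1K_total r (W : set Z) (f : Z -> 'rV[R]_m) :
  Ck_on 1 W f -> cyl r `<=` W -> C1K r f.
Proof.
move=> [df cdf] rW; split.
- by move=> z /rW/df; exact: differentiable_total.
- move=> z /rW/df/differentiable_continuous cf; exact: cvg_within_filter.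
- move=> i; apply: (eq_contK _ ('D_((0 : R), delta_mx 0 i) f)).
    by move=> z /rW/df /(dx_total _ i z) ->.
  by move=> z /rW zW; apply: cvg_within_filter; exact: cdf.
Qed.

(** The derivatives [A] at the origin are orthonormal, so [v] is sent to a row of the same Euclidean
    norm, at least [|v|]. On a small cylinder all derivatives are within [w] of [A], and [w] is
    chosen so that this costs at most half of the bound, for vectors and, by the mean value
    estimate, for pairs of points. *)
Lemma expanding_total (W : set Z) (f : Z -> 'rV[R]_m) : open W -> W (0, 0) ->
  Ck_on 1 W f -> (forall i j, dotv (dx i f (0, 0)) (dx j f (0, 0)) = (i == j)%:R) ->
  exists r, [/\ 0 < r, cyl r `<=` W & expanding r 2^-1 f].
Proof.
move=> oW W0 Cf orth; have [df cdf] := Cf.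
pose A i := dx i f (0, 0).
pose w : R := 2^-1 / (m.+1%:R * n.+1%:R).
have w0 : 0 < w by rewrite divr_gt0// mulr_gt0.
have swap (a b : 'rV[R]_m) : `|a - b| <= w -> `|b - a| <= w by rewrite distrC.
have FF : Filter (nbhs ((0, 0) : Z)) := nbhs_filter _.
have near2 (i : 'I_n) : \forall z \near ((0, 0) : Z),
    `|A i - 'D_((0 : R), delta_mx 0 i) f z| <= w.
  have : 'D_((0 : R), delta_mx 0 i) f z @[z --> ((0, 0) : Z)] --> A i.
    rewrite /A (dx_total f i (0, 0) (df _ W0)).
    exact: cdf ((0 : R), delta_mx 0 i) _ W0.
  by move=> /cvgrPdist_le/(_ _ w0).
have near1 : \forall z \near ((0, 0) : Z), W z /\
    forall i : 'I_n, `|A i - 'D_((0 : R), delta_mx 0 i) f z| <= w.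
  apply: (@filterI _ _ FF); first exact: open_nbhs_nbhs.
  exact: filter_forall _ near2.
have /nbhs_ballP[d /= d0 dP] := near1.
have d20 : 0 < d / 2 by rewrite divr_gt0.
have dcyl z : cyl (d / 2) z -> W z /\
    forall i : 'I_n, `|A i - 'D_((0 : R), delta_mx 0 i) f z| <= w.
  move=> zK; apply: dP; rewrite -ball_normE /= sub0r normrN.
  by rewrite (le_lt_trans zK)// ltr_pdivrMr// ltr_pMr// ltr1n.
have rW : cyl (d / 2) `<=` W by move=> z /dcyl[].
have C1f := C1K_total _ _ _ Cf rW.
have dxA i z : cyl (d / 2) z -> `|dx i f z - A i| <= w.
  move=> zK; have [zW /(_ i) h] := dcyl z zK.
  rewrite (dx_total f i z (df _ zW)); exact: swap h.
have AE (v : 'rV[R]_n) : `|v| <= enorm (\sum_i v 0 i *: A i).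
  have -> : enorm (\sum_i v 0 i *: A i) = enorm v.
    rewrite /enorm; congr Num.sqrt; rewrite dotv_suml; apply: eq_bigr => i _.
    rewrite dotvZl dotv_sumr (bigD1 i)//= big1 => [|j ji].
      by rewrite dotvZr orth eqxx mulr1 addr0.
    by rewrite dotvZr orth eq_sym (negbTE ji) mulr0.
  exact: norm_le_enorm.
have small (a : R) : 0 <= a -> m%:R * (n%:R * w * a) <= 2^-1 * a.
  move=> a0; rewrite !mulrA ler_wpM2r// ler_pdivrMr ?mulr_gt0//.
  by rewrite mulrC ler_wpM2l// ler_pM// ler_nat.
have half (a b s x : R) : a <= s -> b <= 2^-1 * a -> s - b <= x -> 2^-1 * a <= x.
  by lra.
exists (d / 2); split=> //; split=> //.
- move=> z v zK; pose u := \sum_i v 0 i *: dx i f z - \sum_i v 0 i *: A i.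
  have uw : enorm u <= 2^-1 * `|v|.
    apply: le_trans (enorm_le_norm _) _; apply: le_trans (small _ (normr_ge0 v)).
    rewrite ler_wpM2l// /u -sumrB (le_trans (ler_norm_sum _ _ _))//.
    apply: (@le_trans _ _ (\sum_(i < n) `|v| * w)).
      apply: ler_sum => i _; rewrite -scalerBr normrZ ler_pM ?ler_entry_norm//.
      exact: dxA.
    by rewrite sumr_const card_ord -[leLHS]mulr_natl mulrA mulrAC.
  have uE : \sum_i v 0 i *: A i + u = \sum_i v 0 i *: dx i f z.
    by rewrite /u [LHS]addrC subrK.
  have := ler_enorm_sub (\sum_i v 0 i *: A i) (- u).
  by rewrite opprK enormN uE; exact: half (AE v) uw.
- move=> t x x' xK x'K.
  have := C1K_mvt_estimate _ _ _ _ _ A _ (ltW w0) C1f x'K xK.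
  move=> /(_ (fun x'' i x''K _ => dxA i _ x''K)) h.
  pose u := f (t, x) - f (t, x') - \sum_i (x - x') 0 i *: A i.
  have uw : enorm u <= 2^-1 * `|x - x'|.
    apply: le_trans (enorm_le_norm _) _; apply: le_trans (small _ (normr_ge0 _)).
    by rewrite ler_wpM2l.
  have uE : \sum_i (x - x') 0 i *: A i + u = f (t, x) - f (t, x').
    by rewrite /u [LHS]addrC subrK.
  have := ler_enorm_sub (\sum_i (x - x') 0 i *: A i) (- u).
  by rewrite opprK enormN uE; exact: half (AE (x - x')) uw.
Qed.

Lemma expanding_scale r c a (f : Z -> 'rV[R]_m) : 0 <= a ->
  expanding r c f -> expanding r (a * c) (fun z => a *: f z) /\
  forall i z, cyl r z -> dx i (fun z => a *: f z) z = a *: dx i f z.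
Proof.
move=> a0 [Cf h1 h2]; have dE i z : cyl r z -> dx i (fun z => a *: f z) z = a *: dx i f z.
  by move=> zK; rewrite (dxZ _ _ _ _ _ (C1K_cst r a) Cf zK) dx_cst scale0r addr0.
split; last exact: dE.
split; first exact: C1KZ _ _ _ (C1K_cst r a) Cf.
- move=> z v zK; have -> : \sum_i v 0 i *: dx i (fun z => a *: f z) z =
      a *: \sum_i v 0 i *: dx i f z.
    rewrite scaler_sumr; apply: eq_bigr => i _.
    by rewrite dE// !scalerA mulrC.
  by rewrite enormZ ger0_norm// -mulrA ler_wpM2l// h1.
- move=> t x x' xK x'K.
  by rewrite -scalerBr enormZ ger0_norm// -mulrA ler_wpM2l// h2.
Qed.

End InitialMap.

Section QuadraticForms.
Context {R : realType} {n m : nat}.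

Lemma quadform_gram (d : 'I_n -> 'rV[R]_m) v :
  quadform (\matrix_(i, j) dotv (d i) (d j)) v =
  enorm (\sum_i v 0 i *: d i) ^+ 2.
Proof.
rewrite sqr_enorm dotv_suml; apply: eq_bigr => i _.
rewrite dotvZl dotv_sumr mulr_sumr; apply: eq_bigr => j _.
by rewrite mxE dotvZr; ring.
Qed.

Lemma quadform1 (v : 'rV[R]_n) : quadform 1%:M v = dotv v v.
Proof.
apply: eq_bigr => i _; rewrite (bigD1 i)//= big1 => [|j ji].
  by rewrite mxE eqxx mul1r addr0.
by rewrite mxE eq_sym (negbTE ji) !mul0r.
Qed.

Lemma quadformD (A B : 'M[R]_n) v : quadform (A + B) v = quadform A v + quadform B v.
Proof.
rewrite /quadform -big_split; apply: eq_bigr => i _ /=.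
by rewrite -big_split; apply: eq_bigr => j _ /=; rewrite mxE !mulrDl.
Qed.

Lemma quadformZ a (A : 'M[R]_n) v : quadform (a *: A) v = a * quadform A v.
Proof.
rewrite /quadform mulr_sumr; apply: eq_bigr => i _; rewrite mulr_sumr.
by apply: eq_bigr => j _; rewrite mxE !mulrA.
Qed.

End QuadraticForms.

(** * Regularity, embedding and continuity in time *)

Section Conclusions.
Context {R : realType} {n m : nat}.
Local Notation Z := (R * 'rV[R]_n)%type.

(** Uniform continuity is joint in time and space, so closeness in time alone gives closeness
    uniformly in [x]. [g] is compared with [f] for [|x| < r] only, where the derivatives of the
    limit map are known. *)
Lemma contK_uniform_cvg {V : normedModType R} r (f : Z -> V)
    (g : R -> 'rV[R]_n -> V) (K : set 'rV[R]_n) t : contK r f ->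
  (forall s x, `|s| <= r -> `|x| < r -> g s x = f (s, x)) ->
  (forall x, K x -> `|x| < r) -> `|t| < r -> {uniform K, g @ t --> g t}.
Proof.
move=> cf gf Kr tr P /uniform_nbhs[E [+ EP]].
rewrite -entourage_ballE => -[e /= e0 eE].
have [d d0 dP] := contK_unif _ _ cf _ e0.
have : \forall s \near t, `|t - s| < Num.min d (r - `|t|).
  apply: (@filterS _ _ _ _ _ _ (nbhsx_ballx t (Num.min d (r - `|t|)) _)).
    by move=> s; rewrite -ball_normE.
  by rewrite lt_min d0 subr_gt0.
apply: filterS => s; rewrite lt_min => /andP[sd sr]; apply: EP => x Kx /=.
apply: eE => /=; rewrite -ball_normE /=.
have sr' : `|s| <= r.
  have -> : s = t - (t - s) by rewrite subKr.
  by rewrite (le_trans (ler_normB _ _))// addrC -lerBrDr ltW.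
have xr := Kr x Kx.
rewrite !gf ?(ltW tr)//; apply: dP.
- by rewrite /cyl /= prod_normE /= ge_max !ltW.
- by rewrite /cyl /= prod_normE /= ge_max sr' ltW.
- by rewrite prod_normE /= subrr normr0 gt_max sd d0.
Qed.

Lemma contK_slice_continuous {V : normedModType R} r (f : Z -> V) t x :
  contK r f -> `|t| <= r -> `|x| < r -> {for x, continuous (fun x => f (t, x))}.
Proof.
move=> cf tr xr; have FF : Filter (nbhs x) := nbhs_filter x.
suff : (fun x => f (t, x)) @ x --> f (t, x) by [].
apply/cvgrPdist_lt => e e0; have [d d0 dP] := contK_unif _ _ cf _ e0.
have m0 : 0 < Num.min d (r - `|x|) by rewrite lt_min d0 subr_gt0.
apply: (@filterS _ _ FF _ _ _ (nbhsx_ballx x _ m0)) => x'.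
rewrite -ball_normE /= lt_min => /andP[x'd x'r]; apply: dP.
- by rewrite /cyl /= prod_normE /= ge_max tr ltW.
- rewrite /cyl /= prod_normE /= ge_max tr /=.
  have -> : x' = x - (x - x') by rewrite subKr.
  by rewrite (le_trans (ler_normB _ _))// addrC -lerBrDr ltW.
- by rewrite prod_normE /= subrr normr0 gt_max x'd d0.
Qed.

(** The lower bound makes [y] injective with a Lipschitz inverse on the image; [h] picks the
    preimage, with default value [0] off the image. *)
Lemma embedding_of_lower_bound (A : set 'rV[R]_n) (y : 'rV[R]_n -> 'rV[R]_m) c :
  0 < c -> (forall x v, A x -> 'd y x v = 0 -> v = 0) ->
  (forall x x', A x -> A x' -> c * `|x - x'| <= enorm (y x - y x')) ->
  embedding_on A y.
Proof.
move=> c0 dy low; split.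
  move=> x Ax v v' vv'; apply/eqP; rewrite -subr_eq0; apply/eqP.
  by apply: (dy x _ Ax); rewrite linearB; apply/eqP; rewrite subr_eq0 vv'.
have inj x x' : A x -> A x' -> y x = y x' -> x = x'.
  move=> Ax Ax' yy; apply/eqP; rewrite -subr_eq0 -normr_le0 -(pmulr_rle0 _ c0).
  by apply: le_trans (low _ _ Ax Ax') _; rewrite yy subrr enorm0.
pose h u := xget 0 [set x | A x /\ y x = u].
have hy x : A x -> h (y x) = x.
  move=> Ax; rewrite /h; case: xgetP => [x' -> [Ax' yx']|/(_ x)]; first exact: inj.
  by move=> /(_ (conj Ax erefl)).
exists h; split; first exact: hy.
apply/subspace_continuousP => _ [x Ax <-].
have FF : Filter (within (y @` A) (nbhs (y x))) by exact: within_filter.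
apply/cvgrPdist_lt => e e0.
have d0 : 0 < c * e / m.+1%:R by rewrite divr_gt0// mulr_gt0.
have := nbhsx_ballx (y x) _ d0.
rewrite /within /=; apply: (@filterS _ _ (nbhs_filter (y x))) => u + [x' Ax' x'u].
rewrite -ball_normE /= -x'u.
move=> yy; change (`|h (y x) - h (y x')| < e); rewrite (hy x Ax) (hy x' Ax').
rewrite -(ltr_pM2l c0); apply: le_lt_trans (low _ _ Ax Ax') _.
apply: le_lt_trans (enorm_le_norm _) _.
apply: (@le_lt_trans _ _ (m.+1%:R * `|y x - y x'|)).
  by rewrite ler_wpM2r// ler_nat.
by rewrite mulrC -ltr_pdivlMr.
Qed.

(** [Ck_on] asks for continuity of the derivative in every direction; on the open set [A] it
    coincides with a fixed combination of the continuous [D i]. *)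
Lemma Ck1_of_partials (A : set 'rV[R]_n) (y : 'rV[R]_n -> 'rV[R]_m)
    (D : 'I_n -> 'rV[R]_n -> 'rV[R]_m) : open A ->
  (forall x, A x -> differentiable y x /\ forall i, partial i y x = D i x) ->
  (forall i x, A x -> {for x, continuous (D i)}) -> Ck_on 1 A y.
Proof.
move=> oA dy cD; split=> [x /dy[]//|v x Ax].
have e u : A u -> 'D_v y u = \sum_i v 0 i *: D i u.
  move=> /dy[du pu]; rewrite deriveE// diff_rowE//.
  by apply: eq_bigr => i _; rewrite pu.
have FF : Filter (nbhs x) := nbhs_filter x.
suff : 'D_v y u @[u --> x] --> 'D_v y x by [].
rewrite e//.
have : (fun u => \sum_i v 0 i *: D i u) @ x --> \sum_i v 0 i *: D i x.
  elim: (index_enum _) => [|i s ih].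
    by under eq_fun do rewrite big_nil; rewrite big_nil; exact: cvg_cst.
  under eq_fun do rewrite big_cons; rewrite big_cons; apply: cvgD => //.
  by apply: cvgZ; [exact: cvg_cst|exact: cD].
apply: cvg_trans; apply: near_eq_cvg.
by apply: filterS (open_nbhs_nbhs (conj oA Ax)) => u Au; rewrite e.
Qed.

End Conclusions.

(** The cylinder on which the given map is expanding fixes [T] and [Omega] before [eps] is
    introduced. The energy density is the trace of the induced metric, so constancy of the energy
    follows from isometry alone. *)
Theorem theorem6p2 (R : realType)
  (W : set (R * 'rV[R]_3)) (W_open : open W) (W_origin : W (0, 0))
  (u : R -> 'rV[R]_3 -> 'rV[R]_3) (p : R -> 'rV[R]_3 -> R)
  (u_smooth : smooth_on W (fun z => u z.1 z.2))
  (p_smooth : smooth_on W (fun z => p z.1 z.2))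
  (up_euler : forall t x, W (t, x) -> euler_at u p t x)
  (p_gt0 : forall t x, W (t, x) -> 0 < p t x)
  (Rhat : R -> 'rV[R]_3 -> 'I_3 -> 'I_3 -> 'I_3 -> 'I_3 -> R)
  (Rhat_euler : forall t x, W (t, x) ->
     euler_curvature (u t x) (p t x) (Rhat t x))
  (g : R -> 'rV[R]_3 -> 'M[R]_3) (yg : R -> 'rV[R]_3 -> 'rV[R]_6)
  (g_smooth : smooth_on W (fun z => g z.1 z.2))
  (g_riemannian : forall t x, W (t, x) -> riemannian_at (g t x))
  (g_curvature : forall t x, W (t, x) ->
     forall i j k l, riem (g t) i j k l x = Rhat t x i j k l)
  (g_origin : g 0 0 = 1%:M)
  (yg_smooth : smooth_on W (fun z => yg z.1 z.2))
  (yg_embedding : forall t, embedding_on (slice W t) (yg t))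
  (yg_isometric : forall t x, W (t, x) -> induced_metric (yg t) x = g t x)
  (w : R -> R) (w_continuous : continuous w) (B : R) (B_gt0 : 0 < B)
  (yg_short : forall t x, W (t, x) -> forall v : 'rV[R]_3,
     quadform (g t x) v <= quadform (shear_metric B w x) v) :
  exists (T : R) (Omega : set 'rV[R]_3),
    [/\ 0 < T, open Omega, Omega 0,
        (forall t, t \in `]- T, T[ -> Omega `<=` slice W t)
      & forall eps : R, 0 < eps ->
        exists yw : R -> 'rV[R]_3 -> 'rV[R]_6,
          [/\ forall t, t \in `]- T, T[ ->
                Ck_on 1 Omega (yw t) /\ embedding_on Omega (yw t),
              forall t x, t \in `]- T, T[ -> Omega x ->
                induced_metric (yw t) x = shear_metric B w x,
              forall t x, t \in `]- T, T[ -> Omega x ->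
                `|yg t x - yw t x| <= eps,
              (forall t, t \in `]- T, T[ ->
                energy Omega (yw t)
                  = integral3 Omega (fun x => \tr (shear_metric B w x)) /\
                energy Omega (yw t) \is a fin_num) /\
              (forall s t, s \in `]- T, T[ -> t \in `]- T, T[ ->
                energy Omega (yw s) = energy Omega (yw t))
            & continuous_in_C1loc [set` `]- T, T[] Omega yw]].
Proof.
pose f (z : R * 'rV[R]_3) := yg z.1 z.2.
have metric z i j : W z -> dotv (dx i f z) (dx j f z) = g z.1 z.2 i j.
  case: z => t x /yg_isometric/matrixP/(_ i j); rewrite mxE; exact.
have orth i j : dotv (dx i f (0, 0)) (dx j f (0, 0)) = (i == j)%:R.
  by rewrite metric//= g_origin mxE.
have [r [r0 rW ef]] := expanding_total W f W_open W_origin (yg_smooth 1%N) orth.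
pose G (z : R * 'rV[R]_3) := shear_metric B w z.2.
have cG : contK r G := contK_shear_metric r B w w_continuous.
have sG z i j : cyl r z -> G z i j = G z j i by move=> _; exact: shear_metric_sym.
have inT (t : R) : t \in `]- r, r[ -> `|t| < r by rewrite in_itv /= -ltr_norml.
have in_cyl (t : R) (x : 'rV[R]_3) : `|t| < r -> `|x| < r -> cyl r (t, x).
  by move=> tr xr; rewrite /cyl /= prod_normE /= ge_max !ltW.
pose Omega : set 'rV[R]_3 := [set x | `|x| < r].
have oOmega : open Omega.
  have -> : Omega = ball 0 r.
    by apply/seteqP; split=> x; rewrite -ball_normE /Omega /= sub0r normrN.
  exact: ball_open.
exists r, Omega; split; [exact: r0|exact: oOmega|by rewrite /Omega /= normr0| |].
  by move=> t /inT tr x xr; apply: rW; exact: in_cyl.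
move=> eps eps0; have [[_ cf _] low _] := ef.
have [M M0 fM] := contK_bounded _ _ cf.
(* Shrinking makes the map strictly short, also where [g] and the shear metric
   coincide. *)
pose s := Num.min 2^-1 (eps / (2 * M)).
have s0 : 0 < s by rewrite lt_min divr_gt0 ?mulr_gt0// invr_gt0 ltr0n.
have s2 : s <= 2^-1 by rewrite ge_min lexx.
have sM : s * M <= eps / 2.
  have : s <= eps / (2 * M) by rewrite ge_min lexx orbT.
  by rewrite ler_pdivlMr ?mulr_gt0//; lra.
clearbody s.
have s1 : 0 <= 1 - s by lra.
have [ey0 dy0] := expanding_scale r _ _ f s1 ef.
have c0 : 0 < (1 - s) * 2^-1 by lra.
(* Shrinking by [1 - s] frees at least [s] times the metric [H] of the given map. Since
   [quadform H v >= |v|^2 / 4] and [dotv v v <= 9 |v|^2], this is at least [s / 36] times the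
   Euclidean form; half of it is taken as [k]. *)
have k0 : 0 < s / 72 by lra.
have eps20 : 0 < eps / 2 by lra.
have posdef z (v : 'rV[R]_3) : cyl r z -> v != 0 ->
    0 < quadform (\matrix_(i, j) (G z i j
      - dotv (dx i (fun z => (1 - s) *: f z) z) (dx j (fun z => (1 - s) *: f z) z)
      - s / 72 * (i == j)%:R)) v.
  move=> zK v0; pose H := \matrix_(i, j) dotv (dx i f z) (dx j f z).
  have -> : \matrix_(i, j) (G z i j
      - dotv (dx i (fun z => (1 - s) *: f z) z) (dx j (fun z => (1 - s) *: f z) z)
      - s / 72 * (i == j)%:R) =
      G z + (- (1 - s) ^+ 2) *: H + (- (s / 72)) *: 1%:M.
    apply/matrixP => i j; rewrite [LHS]mxE !dy0// dotvZl dotvZr.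
    by move: (G z) => G0; rewrite !mxE; ring.
  rewrite !quadformD !quadformZ quadform1.
  have HG : quadform H v <= quadform (G z) v.
    have -> : H = g z.1 z.2 by apply/matrixP => i j; rewrite mxE metric//; exact: rW.
    by apply: yg_short; apply: rW; case: z {H} zK.
  have Hv : (2^-1 * `|v|) ^+ 2 <= quadform H v.
    by rewrite quadform_gram ler_sqr ?nnegrE ?enorm_ge0 ?low// mulr_ge0.
  have vv : dotv v v <= (3 * `|v|) ^+ 2.
    by rewrite -sqr_enorm ler_sqr ?nnegrE ?enorm_ge0 ?enorm_le_norm// mulr_ge0.
  have v1 : 0 < `|v| ^+ 2 by rewrite exprn_gt0// normr_gt0.
  rewrite !exprMn in Hv vv.
  move: (quadform (G z) v) (quadform H v) (dotv v v) (`|v| ^+ 2) HG Hv vv v1.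
  move=> a b c d ba db cd d0.
  have h1 : 0 <= s * (1 - s) * b.
    by rewrite !mulr_ge0 ?(ltW s0)//; apply: le_trans db; rewrite mulr_ge0 ?sqr_ge0 ?ltW.
  have h2 : 0 <= s * (b - 2^-1 ^+ 2 * d) by rewrite mulr_ge0 ?(ltW s0)// subr_ge0.
  have h3 : 0 <= s * (3 ^+ 2 * d - c) by rewrite mulr_ge0 ?(ltW s0)// subr_ge0.
  have h4 : 0 < s * d by rewrite mulr_gt0.
  (* All terms on the right are nonnegative, and the last is positive. *)
  have -> : a + - (1 - s) ^+ 2 * b + - (s / 72) * c = (a - b) + s * (1 - s) * b
      + s * (b - 2^-1 ^+ 2 * d) + s * (3 ^+ 2 * d - c) / 72 + s * d / 8 by field.
  lra.
have [Y [D [[cY cD] Yy0 dY YG lowY]]] :=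
  local_nash_kuiper r G _ _ _ _ (isT : (5 <= 6)%N) cG sG c0 k0 eps20 ey0 posdef.
pose yw t x := Y (t, x).
have pyw (t : R) (x : 'rV[R]_3) i :
    `|t| <= r -> `|x| < r -> partial i (yw t) x = D i (t, x).
  by move=> tr xr; have [_ /(_ i)] := dY t x tr xr.
have induced (t : R) (x : 'rV[R]_3) : `|t| < r -> `|x| < r ->
    induced_metric (yw t) x = shear_metric B w x.
  move=> tr xr; apply/matrixP => i j; rewrite mxE !pyw ?(ltW tr)//.
  by rewrite YG//; exact: in_cyl.
have energyE (t : R) : t \in `]- r, r[ ->
    energy Omega (yw t) = integral3 Omega (fun x => \tr (shear_metric B w x)).
  move=> /inT tr; apply: eq_integral => q; rewrite inE /= => qr; congr _%:E.
  by rewrite -(induced t)//; apply: eq_bigr => i _; rewrite mxE.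
exists yw; split.
- move=> t /inT tr; split.
    apply: (Ck1_of_partials _ _ (fun i x => D i (t, x))) => // [x xr|i x xr].
      by have [dYx _] := dY t x (ltW tr) xr; split=> // i; rewrite pyw// ltW.
    exact: (contK_slice_continuous _ _ _ _ (cD i) (ltW tr)).
  apply: (embedding_of_lower_bound _ _ _ (divr_gt0 c0 (ltr0n R 2))).
    (* Immersivity is read off the limit metric: the shear metric dominates the positive definite
       [g], so its form cannot vanish at a nonzero [v]. *)
    move=> x v xr dv; have [dYx _] := dY t x (ltW tr) xr.
    apply/eqP/negPn/negP => v0.
    have := (g_riemannian _ _ (rW _ (in_cyl t x tr xr))).2 v v0.
    have := yg_short t x (rW _ (in_cyl t x tr xr)) v.
    rewrite -(induced t x tr xr) quadform_gram.
    have -> : \sum_i v 0 i *: partial i (yw t) x = 'd (yw t) x v.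
      by rewrite diff_rowE.
    by rewrite dv enorm0 expr0n /= => /le_lt_trans h /h; rewrite ltxx.
  by move=> x x' xr x'r; apply: lowY; exact: in_cyl.
- by move=> t x /inT tr xr; exact: induced.
- move=> t x /inT tr xr; have tx := in_cyl t x tr xr.
  (* Shrinking and iterating each use half of [eps]. *)
  have -> : yg t x - yw t x = s *: f (t, x) - (Y (t, x) - (1 - s) *: f (t, x)).
    by apply/rowP => k; rewrite !mxE /f /yw /=; ring.
  rewrite (le_trans (ler_normB _ _))// [leRHS]splitr lerD ?Yy0//.
  rewrite normrZ gtr0_norm// (le_trans _ sM)// ler_wpM2l ?(ltW s0)//.
  exact: fM.
- split=> [t tr|s' t sr tr]; last by rewrite !energyE.
  by rewrite energyE//; split=> //; exact: energy_fin_num.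
- move=> t /inT tr K _ KO; split=> [|i].
    exact: (contK_uniform_cvg r Y).
  by apply: (contK_uniform_cvg r (D i)) => // s' x sr xr; exact: pyw.
Qed.
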